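(* Consider an arrangement of $k$ lines, i.e., a set of $k$ distinct lines in $\mathbb{P}^2$ (over $\mathbb{C}$), and let $t_r$ be the number of points lying on exactly $r$ lines of the arrangement. If $t_r=0$ for $r>\frac23k$, then $$\sum_{r\ge2}rt_r\ge\left\lceil\frac13k^2+k\right\rceil\quad\text{and}\quad\sum_{r\ge2}r^2t_r\ge\left\lceil\frac43k^2\right\rceil.$$ *)

(* Defs.v *)
From HB Require Import structures.
From mathcomp Require Import all_boot all_order all_algebra.
From mathcomp Require Import finmap.
From mathcomp Require Import all_classical all_reals all_analysis.
From mathcomp Require Import complex.

Set Implicit Arguments.
Unset Strict Implicit.
Unset Printing Implicit Defensive.

Import Order.TTheory GRing.Theory Num.Theory.

Local Open Scope ring_scope.
Local Open Scope complex_scope.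

(* P^2(C), with C = R[i], is the projectivization of C^3: its points are the
   one-dimensional and its lines the two-dimensional linear subspaces. *)
Definition projpt (R : realType) : choiceType :=
  {p : {vspace 'rV[R[i]]_3} | \dim p == 1%N}.

Definition projline (R : realType) : choiceType :=
  {l : {vspace 'rV[R[i]]_3} | \dim l == 2%N}.

Definition lies_on (R : realType) (p : projpt R) (l : projline R) : bool :=
  (val p <= val l)%VS.

Definition mult (R : realType) (A : {fset (projline R)}) (p : projpt R) : nat :=
  #|` [fset l in A | lies_on p l]%fset|.

(* Extended-real valued because the set may be infinite when r <= 1: a single
   line has t_1 = +oo, so it is excluded when t_r = 0 is required for all
   r > 2/3. *)
Definition t_ (R : realType) (A : {fset (projline R)}) (r : nat) : \bar R :=
  counting [set p : projpt R | mult A p = r]%classic.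

(* Main.v *)
(* Consider the variety of pairs (point, line through it), and on it the sections
   of [O(p, n)] that vanish along the curve of pairs (x, l), for each line [l] of
   the arrangement, to order [n], where a transversal coordinate of the point has
   weight [k / 3] and the slope has weight [1]. They are the sections of the n-th
   symmetric power of the tangent plane bundle, twisted by [p - n], with parabolic
   weight [3 / k] along each line. This parabolic bundle has [c1 = 0], and the
   theorem is the inequality [c2 >= 0] of Bogomolov for it.

   Semistability (the slope inequality) is seen on a general line of the plane,
   where a section is a polynomial [G] in the position [y] on that line and the
   slope [m]. Orders and degrees being additive, [G] may be taken irreducible. If
   it has degree at least 2 in [m], then its discriminant is not zero, and one
   compares its degree with its orders of vanishing; if it has degree 1, this is
   the hypothesis on the multiplicities. It follows that a section that vanishes
   to order [p - n + 1] over one general point is zero.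

   On the other hand, let [n = 2 k N] and [p - n = E N] with [E] large. Imposing
   first that the sections vanish to order [3 r N] over each point of multiplicity
   [r] makes many of the conditions along the lines redundant. The number of
   remaining conditions cannot be smaller than the dimension, and the coefficients
   of [N ^ 3] give [9 S2 + 12 k <= 8 k ^ 2 + 12 S1], where [S1] and [S2] are the
   sums of the multiplicities and of their squares. As [S2 - S1 = k ^ 2 - k], this
   amounts to either of the two inequalities. *)

From HB Require Import structures.
Require Import Defs.
From mathcomp Require Import all_boot all_order all_algebra.
From mathcomp Require Import finmap.
From mathcomp Require Import all_classical all_reals all_analysis.
From mathcomp Require Import perm polyXY complex.
From mathcomp Require Import zify ring lra.

Set Implicit Arguments.
Unset Strict Implicit.
Unset Printing Implicit Defensive.

Import Order.TTheory GRing.Theory Num.Theory.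

Local Open Scope ring_scope.

(** * Weighted orders and degrees *)

(** Order of vanishing at 0, with the default value [0] for [p = 0]. *)
Definition polyord (R : nzRingType) (p : {poly R}) : nat :=
  find (fun c => c != 0) p.

Lemma polyord_coef (R : nzRingType) (p : {poly R}) : p != 0 -> p`_(polyord p) != 0.
Proof.
move=> p0; rewrite /polyord; apply: (@nth_find _ 0 (fun c => c != 0)); apply/(has_nthP 0);
    exists (size p).-1.
  by rewrite polySpred.
by rewrite -lead_coefE lead_coef_eq0.
Qed.

Lemma polyord_le (R : nzRingType) (p : {poly R}) i : p`_i != 0 -> (polyord p <= i)%N.
Proof. by move=> pi; rewrite leqNgt; apply/negP => /(before_find 0)/negbFE/eqP pi0; rewrite pi0
    eqxx in pi. Qed.

Lemma polyord_ge (R : nzRingType) (p : {poly R}) i : p != 0 ->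
  (forall j, (j < i)%N -> p`_j = 0) -> (i <= polyord p)%N.
Proof.
move=> p0 h; rewrite leqNgt; apply/negP => /h h0.
by have := polyord_coef p0; rewrite h0 eqxx.
Qed.

Lemma coef_lt_polyord (R : nzRingType) (p : {poly R}) i : (i < polyord p)%N -> p`_i = 0.
Proof. by move=> h; apply/eqP; apply: contraTT h => /polyord_le; rewrite -leqNgt. Qed.

Lemma polyordM (R : idomainType) (p q : {poly R}) : p != 0 -> q != 0 ->
  polyord (p * q) = (polyord p + polyord q)%N.
Proof.
move=> p0 q0; apply/eqP; rewrite eqn_leq; apply/andP; split.
  apply: polyord_le; rewrite coefM.
  have lt : (polyord p < (polyord p + polyord q).+1)%N by rewrite ltnS leq_addr.
  rewrite (bigD1 (Ordinal lt)) //= big1 => [|j ne_j].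
    by rewrite addr0 addKn mulf_neq0 // polyord_coef.
  have [jlt|jge] := ltnP j (polyord p); first by rewrite coef_lt_polyord ?mul0r.
  rewrite [q`_ _]coef_lt_polyord ?mulr0 //.
  have : (j != polyord p :> nat)%N by apply: contraNneq ne_j => e; apply/eqP/val_inj.
  by have := ltn_ord j; lia.
apply: polyord_ge => [|j jlt]; first by rewrite mulf_neq0.
rewrite coefM big1 // => i _; have [h|h] := ltnP i (polyord p).
  by rewrite coef_lt_polyord ?mul0r.
by rewrite [q`_ _]coef_lt_polyord ?mulr0 //; have := ltn_ord i; lia.
Qed.

(* The substitution [G(y, m) := G(y s^u, m s^v)], with [s] the outermost variable
   of the result, turns weighted degrees and orders into those of a polynomial
   in one variable over a domain. *)
Section Weighted.
Variables (K : idomainType) (u v : nat).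
Implicit Types G H : {poly {poly K}}.

Definition wt_subst1 : {poly K} -> {poly {poly {poly K}}} :=
  horner_eval ('X%:P%:P * 'X^u) \o map_poly (polyC \o polyC \o polyC).

Definition wt_subst : {poly {poly K}} -> {poly {poly {poly K}}} :=
  horner_eval ('X%:P * 'X^v) \o map_poly wt_subst1.

HB.instance Definition _ := GRing.RMorphism.on wt_subst1.
HB.instance Definition _ := GRing.RMorphism.on wt_subst.

Lemma coef_wt_subst G e b a :
  (wt_subst G)`_e`_b`_a = G`_b`_a *+ (e == u * a + v * b)%N.
Proof.
pose N := (size G + \max_(i < size G) size (nth 0%R G i) + a + b).+1%N.
have sG1 : (size G <= N)%N by rewrite /N; lia.
have sG2 i : (size (G`_i)%R <= N)%N.
  have [h|h] := ltnP i (size G); last by rewrite nth_default ?size_poly0.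
  by have := @leq_bigmax _ (fun j : 'I__ => size (G`_j)%R) (Ordinal h); rewrite /N /=; lia.
have w1E (g : {poly K}) : (size g <= N)%N ->
   wt_subst1 g = \sum_(a' < N) (g`_a' *: 'X^a')%:P%:P * 'X^(u * a').
  move=> sg; rewrite /wt_subst1 /= horner_evalE (@horner_coef_wide _ N); last first.
    by rewrite (leq_trans (size_poly _ _)).
  apply: eq_bigr => i _; rewrite coef_map /= exprMn -exprM -!rmorphXn /=.
  by rewrite mulrA -!polyCM; congr (_%:P%:P * _); rewrite mul_polyC.
have wE : wt_subst G = \sum_(b' < N) \sum_(a' < N)
    ((G`_b'`_a' *: 'X^a')%:P * 'X^b')%:P * 'X^(u * a' + v * b').
  rewrite /wt_subst /= horner_evalE (@horner_coef_wide _ N); last first.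
    by rewrite (leq_trans (size_poly _ _)).
  apply: eq_bigr => i _; rewrite coef_map /= w1E // mulr_suml.
  apply: eq_bigr => j _; rewrite exprMn -exprM -!rmorphXn /= !rmorphM /= exprD.
  by rewrite mulrACA.
rewrite wE !coef_sum.
have ltb : (b < N)%N by rewrite /N; lia.
have lta : (a < N)%N by rewrite /N; lia.
rewrite (bigD1 (Ordinal ltb)) //= [X in _ + X]big1 ?addr0 => [|i ne_i]; last first.
  rewrite !coef_sum big1 // => j _; rewrite coefCM coefXn.
  case: (e == _); rewrite ?mulr0 ?coef0 // mulr1 coefCM coefXn.
  have -> : (b == i) = false by apply: contraNF ne_i => /eqP e'; apply/eqP/val_inj.
  by rewrite mulr0 coef0.
rewrite !coef_sum (bigD1 (Ordinal lta)) //= [X in _ + X]big1 ?addr0 => [|j ne_j].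
  rewrite coefCM coefXn; case: (e == _); rewrite ?mulr0 ?coef0 ?mulr0n //.
  by rewrite mulr1 coefCM coefXn eqxx mulr1 coefZ coefXn eqxx mulr1.
rewrite coefCM coefXn; case: (e == _); rewrite ?mulr0 ?coef0 //.
rewrite mulr1 coefCM coefXn eqxx mulr1 coefZ coefXn.
by have -> : (a == j) = false by [apply: contraNF ne_j => /eqP e'; apply/eqP/val_inj]; rewrite
    mulr0.
Qed.

Lemma coef2_neq0 G : G != 0 -> exists b a, G`_b`_a != 0.
Proof.
move=> G0; exists (size G).-1, (size G`_(size G).-1).-1.
by rewrite -!lead_coefE !lead_coef_eq0.
Qed.

Lemma wt_subst_neq0 G : G != 0 -> wt_subst G != 0.
Proof.
move=> /coef2_neq0 [b [a h]]; apply: contraNneq h => w0.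
by have := coef_wt_subst G (u * a + v * b) b a; rewrite w0 !coef0 eqxx mulr1n => <-.
Qed.

Definition wt_ord G := polyord (wt_subst G).
Definition wt_deg G := (size (wt_subst G)).-1.

Lemma wt_ordM G H : G != 0 -> H != 0 -> wt_ord (G * H) = (wt_ord G + wt_ord H)%N.
Proof. by move=> G0 H0; rewrite /wt_ord rmorphM /= polyordM ?wt_subst_neq0. Qed.

Lemma wt_degM G H : G != 0 -> H != 0 -> wt_deg (G * H) = (wt_deg G + wt_deg H)%N.
Proof.
move=> G0 H0; rewrite /wt_deg rmorphM /= size_mul ?wt_subst_neq0 //.
move: (wt_subst_neq0 G0) (wt_subst_neq0 H0); rewrite -2!size_poly_gt0.
by case: (size _) => // x; case: (size _) => // y _ _ /=; rewrite addnS.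
Qed.

Lemma wt_ord_le G b a : G`_b`_a != 0 -> (wt_ord G <= u * a + v * b)%N.
Proof.
move=> h; apply: polyord_le; apply: contraNneq h => w0.
by have := coef_wt_subst G (u * a + v * b) b a; rewrite w0 !coef0 eqxx mulr1n => <-.
Qed.

Lemma wt_deg_ge G b a : G`_b`_a != 0 -> (u * a + v * b <= wt_deg G)%N.
Proof.
move=> h; have [//|lt] := leqP; case/negP: h; apply/eqP.
have := coef_wt_subst G (u * a + v * b) b a; rewrite eqxx mulr1n => <-.
by rewrite [(wt_subst G)`__]nth_default ?coef0 // (leq_trans (leqSpred _)).
Qed.

Lemma wt_ord_ge G W : G != 0 ->
  (forall b a, (u * a + v * b < W)%N -> G`_b`_a = 0) -> (W <= wt_ord G)%N.
Proof.
move=> G0 h; apply: polyord_ge => [|j jW]; first exact: wt_subst_neq0.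
apply/polyP => b; apply/polyP => a; rewrite coef_wt_subst !coef0.
by case: eqVneq => [je|_]; rewrite ?mulr0n // h ?mul0rn // -je.
Qed.

Lemma wt_deg_le G W : 
  (forall b a, G`_b`_a != 0 -> (u * a + v * b <= W)%N) -> (wt_deg G <= W)%N.
Proof.
move=> h; suff : (size (wt_subst G) <= W.+1)%N by rewrite /wt_deg; case: (size _).
apply/leq_sizeP => j jW; apply/polyP => b; apply/polyP => a; rewrite coef_wt_subst !coef0.
case: eqVneq => [je|_]; rewrite ?mulr0n //.
by apply/eqP; apply: contraLR jW => /h; rewrite je -ltnNge ltnS.
Qed.

End Weighted.

Section Shift.
Variables (K : idomainType) (y0 m0 : K).
Implicit Types G H : {poly {poly K}}.

Definition translate2 : {poly {poly K}} -> {poly {poly K}} :=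
  comp_poly ('X + m0%:P%:P) \o map_poly (comp_poly ('X + y0%:P)).

HB.instance Definition _ := GRing.RMorphism.on translate2.

Lemma translate2_eq0 G : (translate2 G == 0) = (G == 0).
Proof.
have [->|G0] := eqVneq G 0; first by rewrite rmorph0 eqxx.
rewrite /translate2 /= comp_poly2_eq0 ?size_XaddC // map_poly_eq0_id0 ?(negPf G0) //.
by rewrite comp_poly2_eq0 ?size_XaddC ?lead_coef_eq0.
Qed.

End Shift.

(** * Determinants, resultants and discriminants *)

Lemma degree_prod (K : idomainType) (I : Type) (r : seq I) (F : I -> {poly K}) :
  (forall i, F i != 0) ->
  [/\ \prod_(i <- r) F i != 0,
   (size (\prod_(i <- r) F i)).-1 = (\sum_(i <- r) (size (F i)).-1)%N
   & polyord (\prod_(i <- r) F i) = (\sum_(i <- r) polyord (F i))%N].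
Proof.
move=> F0; elim: r => [|i r [IH0 IH1 IH2]].
  rewrite !big_nil size_poly1 oner_eq0; split=> //.
  by apply/eqP; rewrite -leqn0; apply: polyord_le; rewrite coef1 oner_eq0.
rewrite !big_cons mulf_neq0 // polyordM // size_mul // IH2; split=> //.
by rewrite -IH1 (polySpred (F0 i)) (polySpred IH0) /= addnS.
Qed.

Section DetBounds.
Variables (K : idomainType) (N : nat) (M : 'M[{poly K}]_N).

Lemma det_coef_neq0 e : (\det M)`_e != 0 ->
  exists2 s : 'S_N, (forall i, M i (s i) != 0) & (\prod_i M i (s i))`_e != 0.
Proof.
move=> h; have [s hs] : exists s : 'S_N, (\prod_i M i (s i))`_e != 0.
  apply/existsP; apply: contraNT h; rewrite negb_exists => /forallP h.
  rewrite /determinant coef_sum big1 // => s _; move: (h s); rewrite negbK => /eqP h0.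
  by case: (odd_perm s); rewrite ?expr0 ?expr1 ?mul1r // mulN1r coefN h0 oppr0.
exists s => // i; apply: contraNneq hs => M0.
by rewrite (bigD1 i) //= M0 mul0r coef0.
Qed.

(** A nonzero term of the Leibniz expansion has degree at most the sum of the [r i - c (s i)], which
    does not depend on the permutation [s]. *)
Lemma det_degree_le (r c : 'I_N -> nat) : \det M != 0 ->
  (forall i j, M i j != 0 -> ((size (M i j)).-1 + c j <= r i)%N) ->
  ((size (\det M)).-1 + \sum_j c j <= \sum_i r i)%N.
Proof.
move=> D0 h.
have /det_coef_neq0[s s0 hs] : (\det M)`_(size (\det M)).-1 != 0.
  by rewrite -lead_coefE lead_coef_eq0.
have [_ deg _] := degree_prod (index_enum _) s0.
have : ((size (\det M)).-1 <= (size (\prod_i M i (s i))%R).-1)%N.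
  rewrite leqNgt; apply: contraNN hs => lt; rewrite nth_default //.
  by apply: leq_trans lt; apply: leqSpred.
rewrite deg => le1; apply: leq_trans (leq_add le1 (leqnn _)) _.
rewrite [X in (_ + X <= _)%N](reindex_inj (@perm_inj _ s)) /= -big_split /=.
by apply: leq_sum => i _; apply: h.
Qed.

(** The same weighting by rows and columns for orders; the factor [k] allows the weights to be
    fractions with denominator [k]. *)
Lemma det_ord_ge k (r c : 'I_N -> nat) : \det M != 0 ->
  (forall i j, M i j != 0 -> (r i <= k * polyord (M i j) + c j)%N) ->
  (\sum_i r i <= k * polyord (\det M) + \sum_j c j)%N.
Proof.
move=> D0 h.
have /det_coef_neq0[s s0 hs] := polyord_coef D0.
have [_ _ ord] := degree_prod (index_enum _) s0.
have := polyord_le hs; rewrite ord => le1.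
have := leq_mul (leqnn k) le1; rewrite -(leq_add2r (\sum_j c j)); apply: leq_trans.
rewrite big_distrr [X in (_ <= _ + X)%N](reindex_inj (@perm_inj _ s)) /= -big_split /=.
by apply: leq_sum => i _; apply: h.
Qed.

End DetBounds.

Lemma rVpolyE (R : nzRingType) d (v : 'rV[R]_d) :
  rVpoly v = \sum_(i < d) v 0 i *: 'X^i.
Proof. by rewrite /rVpoly poly_def; apply: eq_bigr => i _; rewrite valK. Qed.

Lemma size_exp_XaddC (R : nzRingType) n (a : R) : size (('X + a%:P) ^+ n) = n.+1.
Proof. by rewrite -[a]opprK polyCN size_exp_XsubC. Qed.

(* The Sylvester matrix of a pair of polynomials of *formal* degree [d]. *)
Section Sylvester.
Variables (R : idomainType) (d : nat).
Implicit Types A B : {poly R}.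

Definition sylv A B : 'M[R]_(d + d) :=
  col_mx (\matrix_(i < d, j < d + d) (A * 'X^i)`_j)
         (\matrix_(i < d, j < d + d) (B * 'X^i)`_j).

(** The two halves of a row vector in the kernel are the coefficients of [U] and [V]. *)
Lemma sylv_eq0 A B : (size A <= d.+1)%N -> (size B <= d.+1)%N ->
  \det (sylv A B) = 0 ->
  exists U V : {poly R}, [/\ (size U <= d)%N, (size V <= d)%N,
    (U != 0) || (V != 0) & U * A + V * B = 0].
Proof.
move=> sA sB /eqP/det0P[v v0 hv].
exists (rVpoly (lsubmx v)), (rVpoly (rsubmx v)).
split; try exact: size_poly.
  rewrite -negb_and; apply: contraNN v0 => /andP[/eqP h1 /eqP h2].
  rewrite -[v]hsubmxK.
  have -> : lsubmx v = 0 by rewrite -[lsubmx v]rVpolyK h1 linear0.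
  have -> : rsubmx v = 0 by rewrite -[rsubmx v]rVpolyK h2 linear0.
  by rewrite row_mx0.
have sz (U : 'rV_d) (C : {poly R}) : (size C <= d.+1)%N -> (size (rVpoly U * C)%R <= d + d)%N.
  move=> sC; apply: leq_trans (size_polyMleq _ _) _.
  have := size_poly d (fun k => oapp (U 0) 0 (insub k)).
  rewrite -[\poly_(_ < _) _]/(rVpoly U).
  by move=> sU; have := leq_add sU sC; rewrite addnS; case: (_ + _)%N.
apply/polyP => j; rewrite coef0; have [lt|ge] := ltnP j (d + d); last first.
  by rewrite coefD !nth_default ?addr0 // (leq_trans (sz _ _ _)).
have /rowP/(_ (Ordinal lt)) := hv; rewrite -[v in v *m _]hsubmxK mul_row_col !mxE.
move=> e; rewrite coefD -[RHS]e; congr (_ + _); rewrite rVpolyE mulr_suml coef_sum;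
  by apply: eq_bigr => i _; rewrite -scalerAl coefZ !mxE ['X^i * _]mulrC.
Qed.

Definition shiftmx m (c : R) : 'M[R]_m := \matrix_(i < m, j < m) (('X + c%:P) ^+ i)`_j.

Lemma det_shiftmx m c : \det (shiftmx m c) = 1.
Proof.
have sz i : size (('X + c%:P) ^+ i) = i.+1 by rewrite size_exp_XaddC.
rewrite det_trig; last first.
  by apply/is_trig_mxP => i j lt; rewrite mxE nth_default // sz.
rewrite big1 // => i _; rewrite mxE.
have /monicP := monic_exp i (monicXaddC c).
by rewrite lead_coefE sz.
Qed.

(** Translation acts on the columns by [shiftmx (d + d) c] and on the multipliers [X^i] by
    [shiftmx d c]; both matrices are unitriangular. *)
Lemma det_sylv_comp A B c : (size A <= d.+1)%N -> (size B <= d.+1)%N ->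
  \det (sylv (A \Po ('X + c%:P)) (B \Po ('X + c%:P))) = \det (sylv A B).
Proof.
move=> sA sB.
have key (C : {poly R}) : (size C <= d.+1)%N ->
   shiftmx d c *m (\matrix_(i < d, j < d + d) ((C \Po ('X + c%:P)) * 'X^i)`_j) =
   (\matrix_(i < d, j < d + d) (C * 'X^i)`_j) *m shiftmx (d + d) c.
  move=> sC; apply/matrixP => i j; rewrite !mxE.
  transitivity ((C * 'X^i) \Po ('X + c%:P))`_j.
    rewrite comp_polyM comp_Xn_poly mulrC.
    rewrite [('X + _) ^+ _](_ : _ = \sum_(l < d) (('X + c%:P) ^+ i)`_l *: 'X^l).
      rewrite mulr_suml coef_sum; apply: eq_bigr => l _.
      by rewrite !mxE -scalerAl coefZ ['X^l * _]mulrC.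
    rewrite -poly_def; apply/polyP => l; rewrite coef_poly.
    by case: ltnP => // le; rewrite nth_default // size_exp_XaddC (leq_trans (ltn_ord i)).
  rewrite coef_comp_poly.
  have sz : (size (C * 'X^i)%R <= d + d)%N.
    apply: leq_trans (size_polyMleq _ _) _; rewrite size_polyXn.
    by have := leq_add sC (ltn_ord i); rewrite addSn; case: (_ + _)%N.
  rewrite (big_ord_widen _ (fun l => (C * 'X^i)`_l * (('X + c%:P) ^+ l)`_j) sz).
  rewrite big_mkcond /=; apply: eq_bigr => l _; rewrite !mxE.
  by case: ltnP => // le; rewrite nth_default ?mul0r.
have : \det (block_mx (shiftmx d c) 0 0 (shiftmx d c) *m
           sylv (A \Po ('X + c%:P)) (B \Po ('X + c%:P))) =
       \det (sylv A B *m shiftmx (d + d) c).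
  by rewrite /sylv mul_block_col mul_col_mx !mul0mx addr0 add0r !key.
by rewrite !det_mulmx det_ublock !det_shiftmx !mul1r mulr1.
Qed.

Lemma det_sylv_sub A B c : \det (sylv (A - c *: B) B) = \det (sylv A B).
Proof.
have -> : sylv (A - c *: B) B = block_mx 1%:M (- c)%:M 0 1%:M *m sylv A B.
  rewrite /sylv mul_block_col !mul1mx mul0mx add0r mul_scalar_mx; congr col_mx.
  by apply/matrixP => i j; rewrite !mxE mulrBl coefB -scalerAl coefZ mulNr.
by rewrite det_mulmx det_ublock !det1 !mul1r.
Qed.

End Sylvester.

(* Up to a constant, the discriminant of [G] as a form of degree [d.+1]: the
   resultant of its two partial derivatives. Unlike the resultant of [G] and
   [G'], it has no spurious factor [lead_coef G]. *)
Section Disc.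
Variables (R : idomainType) (d : nat).
Implicit Types G : {poly R}.

(** By Euler's relation, the partial derivative in the homogenizing variable of [G] seen as a form
    of degree [d.+1]. *)
Definition polar G := G *+ d.+1 - 'X * G^`().
Definition disc G := \det (sylv d (polar G) G^`()).

Lemma coef_polar G j : (polar G)`_j = (d.+1%:R - j%:R) * G`_j.
Proof.
rewrite coefB coefMn coefXM coef_deriv mulrBl !mulr_natl.
by case: j => [|j] //=; rewrite mulr0n.
Qed.

Lemma size_polar G : (size G <= d.+2)%N -> (size (polar G) <= d.+1)%N.
Proof.
move=> sG; apply/leq_sizeP => j; rewrite leq_eqVlt => /orP[/eqP<-|lt]; rewrite coef_polar.
  by rewrite subrr mul0r.
by rewrite nth_default ?mulr0 // (leq_trans sG).
Qed.

Lemma size_deriv_le G : (size G <= d.+2)%N -> (size G^`() <= d.+1)%N.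
Proof.
move=> sG; have [->|G0] := eqVneq G 0; first by rewrite deriv0 size_poly0.
by rewrite -ltnS (leq_trans (lt_size_deriv G0)).
Qed.

Lemma disc_comp G c : (size G <= d.+2)%N -> disc (G \Po ('X + c%:P)) = disc G.
Proof.
move=> sG; rewrite /disc -(det_sylv_comp c (size_polar sG) (size_deriv_le sG)).
have dG : (G \Po ('X + c%:P))^`() = G^`() \Po ('X + c%:P).
  by rewrite deriv_comp derivD derivX derivC addr0 mulr1.
(* The polar of the translate is the translate of the polar plus [c] times that of the derivative; a
   row operation removes the extra term. *)
rewrite dG -(det_sylv_sub _ _ _ c); congr (\det (sylv _ _ _)).
rewrite /polar dG comp_polyB comp_polyM comp_polyX linearMn /= mulrDl.
by rewrite opprD addrA mul_polyC.
Qed.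

Hypothesis char0 : forall n, n.+1%:R != 0 :> R.

(** A relation [U * polar G + V * G' = 0] makes [G'] divide a multiple of [U * G]. If [G] and [G']
    were coprime, [G'] would divide [U], which has smaller degree; so [U = 0], and then [V = 0]. *)
Lemma disc_eq0 G : size G = d.+2 -> (0 < d)%N -> disc G = 0 ->
  ~~ coprimep G G^`().
Proof.
move=> sG d0 D0; apply/negP => cop.
have sB : size G^`() = d.+1.
  apply/eqP; rewrite eqn_leq size_deriv_le ?sG //= ltnNge; apply/negP => /leq_sizeP/(_ d (leqnn
      d)).
  move/eqP; rewrite coef_deriv -mulr_natr mulf_eq0 (negPf (char0 d)) orbF.
  by apply/negP; rewrite -[d.+1]/(d.+2.-1) -sG -lead_coefE lead_coef_eq0 -size_poly_gt0 sG.
have [U [V [sU sV nz e]]] := sylv_eq0 (size_polar (eq_leq sG)) (size_deriv_le (eq_leq sG)) D0.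
have B0 : G^`() != 0 by rewrite -size_poly_gt0 sB.
have dv : G^`() %| (U *+ d.+1) * G.
  have -> : (U *+ d.+1) * G = (U * 'X - V) * G^`().
    apply/eqP; rewrite -subr_eq0 -[X in _ == X]e /polar; apply/eqP.
    rewrite mulrBr mulrnAr mulrnAl mulrBl mulrA opprB -[RHS]addrA; congr (_ + _).
    by rewrite addrC.
  exact: dvdp_mull.
rewrite coprimep_sym in cop.
rewrite Gauss_dvdpl // in dv.
have U0 : U = 0.
  apply/eqP; apply: contraTT isT => U0; rewrite -scaler_nat dvdpZr ?char0 // in dv.
  by have := leq_trans (dvdp_leq U0 dv) sU; rewrite sB ltnn.
move: nz e; rewrite U0 mul0r add0r eqxx /= => V0 /eqP.
by rewrite mulf_eq0 (negPf V0) (negPf B0).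
Qed.

End Disc.

Lemma disc_map (R S : idomainType) (f : {rmorphism R -> S}) d (G : {poly R}) :
  disc d (map_poly f G) = f (disc d G).
Proof.
rewrite /disc -det_map_mx /sylv map_col_mx; congr (\det (col_mx _ _));
  apply/matrixP => i j; rewrite !mxE !coefMXn; case: ifP => _; rewrite ?rmorph0 //.
- by rewrite !coef_polar coef_map rmorphM rmorphB /= !rmorph_nat.
- by rewrite deriv_map coef_map.
Qed.

Lemma polyord_scale (R : idomainType) (c : R) (p : {poly R}) : c != 0 -> p != 0 ->
  polyord (c *: p) = polyord p.
Proof.
move=> c0 p0; apply/eqP; rewrite eqn_leq; apply/andP; split.
  by apply: polyord_le; rewrite coefZ mulf_neq0 // polyord_coef.
apply: polyord_ge => [|j h]; first by rewrite -size_poly_eq0 size_scale ?size_poly_eq0.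
by rewrite coefZ coef_lt_polyord ?mulr0.
Qed.

Section DiscBounds.
Variables (K : idomainType) (d : nat) (G : {poly {poly K}}).
Hypothesis D0 : disc d G != 0.

(** The factors [c] are constants of [K], so the degrees and orders of the entries are those of
    coefficients of [G]. *)
Lemma sylv_entryP (i j : 'I_(d + d)) :
  let M := sylv d (polar d G) G^`() in M i j != 0 ->
  match fintype.split i with
  | inl a => exists2 c : K, c != 0 & [/\ (a <= j)%N, M i j = c *: G`_(j - a) & G`_(j - a) != 0]
  | inr a => exists2 c : K, c != 0 & [/\ (a <= j)%N, M i j = c *: G`_(j - a).+1 & G`_(j - a).+1
      != 0]
  end.
Proof.
rewrite /sylv /= mxE; case: fintype.split => a; rewrite mxE coefMXn; case: ltnP => // le;
    rewrite ?eqxx //.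
- rewrite coef_polar -!(rmorph_nat (@polyC K)) -polyCB mul_polyC => h; exists (d.+1%:R - (j -
    a)%:R).
    by apply: contraNneq h => ->; rewrite scale0r.
  by split=> //; apply: contraNneq h => ->; rewrite scaler0.
- rewrite coef_deriv -mulr_natl -(rmorph_nat (@polyC K)) mul_polyC => h; exists ((j - a).+1%:R).
    by apply: contraNneq h => ->; rewrite scale0r.
  by split=> //; apply: contraNneq h => ->; rewrite scaler0.
Qed.

Lemma sum_ord m : (\sum_(i < m) i * 2 + m = m * m)%N.
Proof.
elim: m => [|m IHm]; first by rewrite big_ord0.
by rewrite big_ord_recr /=; move: IHm; set s := (\sum_(i < m) _)%N; lia.
Qed.

(** The Sylvester matrix is graded: weights [T + a] and [T - 1 + a] on the rows of the two blocks,
    [j] on the columns. The sums of these weights differ by [2 d T - d (d + 1)]. *)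
Lemma disc_degree_le T : (0 < T)%N -> (forall j, G`_j != 0 -> ((size (G`_j)%R).-1 + j <= T)%N)
    ->
  ((size (disc d G)).-1 + d * d.+1 <= 2 * d * T)%N.
Proof.
move=> T0 hT.
have := @det_degree_le _ _ _ (fun i => match fintype.split i with inl a => T + a | inr a =>
    T.-1 + a end)%N
   (fun j => j) D0.
rewrite -/(disc d G).
have -> : (\sum_(i < d + d) match fintype.split i with inl a => T + a | inr a => T.-1 + a end =
   d * T + d * T.-1 + \sum_(i < d) i * 2)%N.
  rewrite big_split_ord /=.
  under eq_bigr => i _ do rewrite (unsplitK (inl i)).
  under [X in (_ + X)%N]eq_bigr => i _ do rewrite (unsplitK (inr i)).
  rewrite !big_split /= !sum_nat_const !card_ord.
  have -> : (\sum_(i < d) i * 2 = \sum_(i < d) i + \sum_(i < d) i)%N.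
    by rewrite -big_split /=; apply: eq_bigr => i _; rewrite muln2 addnn.
  by rewrite addnACA.
move=> h; have {h} h1 : ((size (disc d G)).-1 + \sum_(j < d + d) j <= d * T + d * T.-1 +
    \sum_(i < d) i * 2)%N.
  apply: h => i j /sylv_entryP; case: fintype.split => a [c c0 [aj -> g0]]; rewrite size_scale
      //.
    by move: (hT _ g0); lia.
  by move: (hT _ g0); lia.
have e1 := sum_ord d; rewrite -big_distrl /= in e1 h1; have e2 := sum_ord (d + d); rewrite
    -big_distrl /= in e2.
case: T T0 hT h1 => // T _ _ /=; move: e1 e2; set s1 := (\sum_(i < d) _)%N; set s2 := (\sum_(i
    < d + d) _)%N.
set D := (size _).-1; nia.
Qed.

(** The same grading with weight 3 per index. Where [W + 3 * a - 3] is truncated it exceeds the true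
    value, which is harmless in a lower bound for the sum of the row weights. *)
Lemma disc_ord_ge k W : (forall j, G`_j != 0 -> (W <= k * polyord (G`_j)%R + 3 * j)%N) ->
  (2 * d * W <= k * polyord (disc d G) + 3 * (d * d.+1))%N.
Proof.
move=> hW.
have := @det_ord_ge _ _ _ k (fun i => match fintype.split i with inl a => W + 3 * a | inr a =>
    W + 3 * a - 3 end)%N
   (fun j => 3 * j)%N D0.
rewrite -/(disc d G).
have le : (2 * d * W + 3 * \sum_(i < d) i * 2 <= \sum_(i < d + d) match fintype.split i with
    inl a => W + 3 * a | inr a => W + 3 * a - 3 end + 3 * d)%N.
  rewrite big_split_ord /=.
  under [X in (_ <= X + _ + _)%N]eq_bigr => i _ do rewrite (unsplitK (inl i)).
  under [X in (_ <= _ + X + _)%N]eq_bigr => i _ do rewrite (unsplitK (inr i)).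
  have -> : (3 * d = \sum_(i < d) 3)%N by rewrite sum_nat_const card_ord mulnC.
  rewrite -addnA -big_split /= -mulnA mul2n -addnn.
  have -> : (3 * (\sum_(i < d) i * 2) = \sum_(i < d) (3 * i) + \sum_(i < d) (3 * i))%N.
    by rewrite -big_split /= big_distrr /=; apply: eq_bigr => i _; lia.
  have -> : (d * W = \sum_(i < d) W)%N by rewrite sum_nat_const card_ord.
  by rewrite addnACA -!big_split /=; apply: leq_sum => i _; lia.
move=> h; have {h} h1 := h _; have {h1} : (\sum_(i < d + d) match fintype.split i with inl a =>
    W + 3 * a | inr a => W + 3 * a - 3 end <=
     k * polyord (disc d G) + \sum_(j < d + d) 3 * j)%N.
  apply: h1 => i j /sylv_entryP; case: fintype.split => a [c c0 [aj -> g0]]; rewrite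
      polyord_scale //.
    by move: (hW _ g0); lia.
  by move: (hW _ g0); lia.
rewrite -big_distrr /=; move: le.
have e1 := sum_ord d; rewrite -big_distrl /= in e1 *; have e2 := sum_ord (d + d); rewrite
    -big_distrl /= in e2.
move: e1 e2; set s1 := (\sum_(i < d) _)%N; set s2 := (\sum_(i < d + d) i)%N.
set D := polyord _; set S := (\sum_(i < d + d) _)%N; nia.
Qed.

End DiscBounds.

(** * The slope inequality *)

Lemma sum_const_seq (I : Type) (s : seq I) n : (\sum_(i <- s) n = size s * n)%N.
Proof. by elim: s => [|i s IHs]; rewrite ?big_nil // big_cons IHs mulSn. Qed.

Section SlopeBound.
Variable K : numClosedFieldType.
Implicit Types (G P Q : {poly {poly K}}) (p c : {poly K}).

(** Splitting off a root [a] that lies in [s] lowers the degree by 1 and, among the orders, only the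
    one at [a], also by 1. *)
Lemma sum_polyord_le p (s : seq K) : p != 0 -> uniq s ->
  (\sum_(y <- s) polyord (p \Po ('X + y%:P)) <= (size p).-1)%N.
Proof.
elim: {p}(size p) {-2}p (leqnn (size p)) => [|n IHn] p sp p0 us.
  by rewrite -size_poly_gt0 ltnNge sp in p0.
have ordN y : p.[y] != 0 -> polyord (p \Po ('X + y%:P)) = 0%N.
  move=> h; apply/eqP; rewrite -leqn0; apply: polyord_le.
  by rewrite -horner_coef0 horner_comp hornerD hornerX hornerC add0r.
have [/hasP[a as_ /rootP ra]|noroot] := boolP (has (root p) s); last first.
  rewrite big_seq big1 // => y ys; apply: ordN.
  by apply: contraNneq noroot => h; apply/hasP; exists y => //; apply/rootP.
have /factor_theorem[q pE] : root p a by apply/rootP.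
have q0 : q != 0 by apply: contraNneq p0; rewrite pE => ->; rewrite mul0r.
have X0 : ('X - a%:P : {poly K}) != 0 by rewrite polyXsubC_eq0.
have sE : size p = (size q).+1 by rewrite pE size_Mmonic ?monicXsubC // size_XsubC addn2.
rewrite sE ltnS in sp *; have := IHn q sp q0 us; rewrite /= => IH.
have q1 : (0 < size q)%N by rewrite size_poly_gt0.
rewrite -(prednK q1) -add1n; apply: leq_trans (leq_add (leqnn 1%N) IH).
have ordE y : polyord (p \Po ('X + y%:P)) = ((y == a) + polyord (q \Po ('X + y%:P)))%N.
  rewrite pE comp_polyM polyordM ?comp_poly2_eq0 ?size_XaddC // addnC; congr (_ + _)%N.
  rewrite comp_polyB comp_polyX comp_polyC -addrA -polyCB.
  have [->|ya] := eqVneq y a.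
    by rewrite subrr addr0; apply/eqP; rewrite eqn_leq polyord_le ?coefX ?oner_eq0 // 
       polyord_ge ?polyX_eq0 // => -[|//]; rewrite coefX.
  by apply/eqP; rewrite -leqn0 polyord_le // coefD coefX coefC add0r subr_eq0.
under eq_bigr => y _ do rewrite ordE.
rewrite big_split /= leq_add2r.
rewrite (bigD1_seq a) //= eqxx big1 // => y /negPf -> //.
Qed.

Lemma divide_content a P : (forall j, (P`_j).[a] = 0) ->
  exists P', P = ('X - a%:P) *: P'.
Proof.
move=> h; exists (map_poly (fun c => c %/ ('X - a%:P)) P); apply/polyP => j.
rewrite coefZ coef_map_id0 ?div0p // mulrC divpK // dvdp_XsubCl.
by apply/rootP.
Qed.

(** Gauss's lemma: at a root [a] of [c] the product [P * Q] specializes to zero in a domain, so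
    ['X - a] divides all coefficients of one factor and can be cancelled. *)
Lemma cancel_content c G P Q : c != 0 -> c *: G = P * Q ->
  exists P' Q', [/\ G = P' * Q', size P' = size P & size Q' = size Q].
Proof.
elim: {c}(size c) {-2}c (leqnn (size c)) P Q => [|n IHn] c sc P Q c0 e.
  by rewrite -size_poly_gt0 ltnNge sc in c0.
have [/size_poly1P[a a0 cE]|s1] := boolP (size c == 1%N).
  exists (a^-1%:P *: P), Q; split => //; last by rewrite size_scale // polyC_eq0 invr_eq0.
  by rewrite -scalerAl -e cE scalerA -polyCM mulVf // scale1r.
have /closed_rootP[a ra] := s1.
have [d cE] := factor_theorem _ _ ra.
have d0 : d != 0 by apply: contraNneq c0; rewrite cE => ->; rewrite mul0r.
have X0 : ('X - a%:P : {poly K}) != 0 by rewrite polyXsubC_eq0.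
have X0' : ('X - a%:P : {poly K})%:P != 0 by rewrite polyC_eq0.
have sd : (size d <= n)%N.
  by rewrite cE size_Mmonic ?monicXsubC // size_XsubC addn2 in sc.
have sX P' : size (('X - a%:P) *: P') = size P' by rewrite size_scale.
have : map_poly (horner_eval a) P * map_poly (horner_eval a) Q = 0.
  rewrite -rmorphM -e; apply/polyP => j.
  by rewrite coef_map /= coefZ horner_evalE hornerM (rootP ra) mul0r coef0.
move/eqP; rewrite mulf_eq0 => /orP[] /eqP h.
- have [|P' PE] := @divide_content a P.
    by move=> j; have /polyP/(_ j) := h; rewrite coef_map coef0.
  have [|P2 [Q2 [-> s2 s3]]] := IHn d sd P' Q d0.
    by apply: (mulfI X0'); rewrite !mul_polyC scalerA mulrC -cE e PE -scalerAl.
  by exists P2, Q2; split; rewrite // PE sX.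
- have [|Q' QE] := @divide_content a Q.
    by move=> j; have /polyP/(_ j) := h; rewrite coef_map coef0.
  have [|P2 [Q2 [-> s2 s3]]] := IHn d sd P Q' d0.
    by apply: (mulfI X0'); rewrite !mul_polyC scalerA mulrC -cE e QE -scalerAr.
  by exists P2, Q2; split; rewrite // QE sX.
Qed.

(** The gcd of [G] and its derivative is a proper factor of [G] up to a multiplier [c] free of the
    slope, and [cancel_content] removes [c]. *)
Lemma disc_eq0_factor d G : size G = d.+2 -> (0 < d)%N -> disc d G = 0 ->
  exists P Q, [/\ G = P * Q, (1 < size P)%N & (1 < size Q)%N].
Proof.
move=> sG d0 D0.
have ch n : n.+1%:R != 0 :> {poly K} by rewrite -polyC_natr polyC_eq0 pnatr_eq0.
have := disc_eq0 ch sG d0 D0; rewrite coprimep_def => s1.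
have G0 : G != 0 by rewrite -size_poly_gt0 sG.
have g0 : gcdp G G^`() != 0 by rewrite gcdp_eq0 (negPf G0).
have s2 : (1 < size (gcdp G G^`()))%N by rewrite ltn_neqAle eq_sym s1 size_poly_gt0.
have dG0 : G^`() != 0.
  have := coef_deriv G d => h.
  apply: contraTneq isT => e; move: h; rewrite e coef0 => /esym/eqP.
  rewrite -mulr_natr mulf_eq0 (negPf (ch d)) orbF -[d.+1]/(d.+2.-1) -sG.
  by rewrite -lead_coefE lead_coef_eq0 (negPf G0).
have s3 : (size (gcdp G G^`()) < size G)%N.
  exact: leq_ltn_trans (dvdp_leq dG0 (dvdp_gcdr _ _)) (lt_size_deriv G0).
have /Pdiv.WeakIdomain.dvdpP[[c q] /= c0 e] := dvdp_gcdl G G^`().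
have q0 : q != 0.
  by apply: contraNneq G0 => q0; move: e; rewrite q0 mul0r => /eqP; rewrite -mul_polyC mulf_eq0
      polyC_eq0 (negPf c0).
have := congr1 (fun r : {poly {poly K}} => size r) e.
rewrite size_scale // size_mul //= => sE.
have [P [Q [GE sP sQ]]] := cancel_content c0 e.
exists P, Q; rewrite sQ sP; split=> //; move: s2 s3; rewrite sE.
by case: (size q) => [|[|]//] /=; rewrite ?add0n ?add1n /= => h; rewrite ?ltnn // ltnNge
    leq_pred.
Qed.

(** A line [Y = M X + C] is recorded as the pair [(C, M)]: its position on the line [X = 0] and its
    slope. Concurrent lines give collinear pairs, so [collinear] is the hypothesis on the
    multiplicities. *)
Variable q : seq (K * K).
Let k := size q.
Hypothesis uniq1 : uniq [seq z.1 | z <- q].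
Hypothesis collinear : forall a b : K,
  (3 * count (fun z => z.2 == a * z.1 + b)%R q <= 2 * k)%N.

(** The weights [k / 3] of the position and [1] of the slope, multiplied by 3. *)
Definition line_ord G (z : K * K) := wt_ord k 3 (translate2 z.1 z.2 G).

Lemma line_ordM P Q z : P != 0 -> Q != 0 -> line_ord (P * Q) z = (line_ord P z + line_ord Q
    z)%N.
Proof. by move=> P0 Q0; rewrite /line_ord rmorphM wt_ordM ?translate2_eq0. Qed.

(** Both sides are additive for products, so the inequality passes from factors to products. *)
Definition slope_bound G :=
  (\sum_(z <- q) line_ord G z <= k * (wt_deg 1 1 G + (size G).-1))%N.

Lemma slope_boundM P Q : P != 0 -> Q != 0 -> slope_bound P -> slope_bound Q -> slope_bound (P *
    Q).
Proof.
move=> P0 Q0 cP cQ; rewrite /slope_bound (eq_bigr _ (fun z _ => line_ordM z P0 Q0)) big_split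
    /=.
apply: leq_trans (leq_add cP cQ) _; rewrite wt_degM // size_mul //.
rewrite -mulnDr leq_mul2l (polySpred P0) (polySpred Q0) /= addnS /=.
by rewrite addnACA leqnn orbT.
Qed.

(** The order along a line is at most [k] times the order of [c] at its position, and at distinct
    positions these orders add up to at most the degree of [c]. *)
Lemma slope_bound_const c : c != 0 -> slope_bound c%:P.
Proof.
move=> c0; rewrite /slope_bound size_polyC c0 /= addn0.
have le z : (line_ord c%:P z <= k * polyord (c \Po ('X + z.1%:P)))%N.
  have -> : (k * polyord (c \Po ('X + z.1%:P)) = k * polyord (c \Po ('X + z.1%:P)) + 3 * 0)%N
      by rewrite muln0 addn0.
  apply: wt_ord_le; rewrite /translate2 /= map_polyC comp_polyC coefC /=.
  by apply: polyord_coef; rewrite comp_poly2_eq0 ?size_XaddC.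
apply: leq_trans (@leq_sum _ q xpredT _ _ (fun z _ => le z)) _.
rewrite -big_distrr /= leq_mul2l; apply/orP; right.
have := sum_polyord_le c0 uniq1; rewrite big_map => /leq_trans -> //.
rewrite -[(size c).-1]mul1n -[(1 * _)%N]addn0; apply: (@wt_deg_ge _ 1 1 _ 0%N).
by rewrite coefC -lead_coefE lead_coef_eq0.
Qed.

(** As the two coefficients have no common root, every order is at most 3, which suffices if the
    total degree is at least 2. If it is 1, then [G = 0] is a line in the plane of positions and
    slopes, and [collinear] bounds the number of pairs on it. *)
Lemma slope_bound_linear G : size G = 2%N -> (forall a, ((G`_0).[a] != 0) || ((G`_1).[a] != 0))
    -> slope_bound G.
Proof.
move=> sG noroot; rewrite /slope_bound sG /=.
have G1 : G`_1 != 0 by rewrite -[1%N]/(2.-1) -sG -lead_coefE lead_coef_eq0 -size_poly_gt0 sG.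
have GE : G = (G`_1)%:P * 'X + (G`_0)%:P.
  apply/polyP => -[|[|j]]; rewrite coefD coefMX !coefC ?add0r ?addr0 //=.
  by rewrite nth_default // sG.
have shE z : translate2 z.1 z.2 G =
   (G`_1 \Po ('X + z.1%:P))%:P * 'X + ((G`_1 \Po ('X + z.1%:P)) * z.2%:P + (G`_0 \Po ('X +
       z.1%:P)))%:P.
  rewrite [in LHS]GE rmorphD rmorphM /= /translate2 /= map_polyX comp_polyX !map_polyC /=
      !comp_polyC.
  by rewrite mulrDr polyCD polyCM addrA.
have ev (p : {poly K}) (y : K) : (p \Po ('X + y%:P))`_0 = p.[y].
  by rewrite -horner_coef0 horner_comp hornerD hornerX hornerC add0r.
have c1 z : (translate2 z.1 z.2 G)`_1`_0 = (G`_1).[z.1].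
  by rewrite shE coefD coefMX !coefC /= addr0 ev.
have c0 z : (translate2 z.1 z.2 G)`_0`_0 = (G`_1).[z.1] * z.2 + (G`_0).[z.1].
  by rewrite shE coefD coefMX !coefC /= add0r coefD coefMC !ev.
have le3 z : (line_ord G z <= 3)%N.
  have [h|h] := eqVneq ((G`_1).[z.1]) 0.
    apply: leq_trans (_ : 0 <= 3)%N => //.
    have := noroot z.1; rewrite h eqxx orbF => h0.
    rewrite -[0%N]/(0 + 0)%N -{1}(muln0 k) -(muln0 3%N); apply: wt_ord_le.
    by rewrite c0 h mul0r add0r.
  have -> : 3%N = (k * 0 + 3 * 1)%N by rewrite muln0 muln1.
  by apply: wt_ord_le; rewrite c1.
have T1 : (1 <= wt_deg 1 1 G)%N.
  have := wt_deg_ge 1 1 (_ : G`_1`_(size G`_1).-1 != 0).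
  rewrite -lead_coefE lead_coef_eq0 => /(_ G1); lia.
have [T2|T2] := leqP 2 (wt_deg 1 1 G).
  apply: leq_trans (@leq_sum _ q xpredT _ _ (fun z _ => le3 z)) _.
  by rewrite sum_const_seq leq_mul2l; apply/orP; right; lia.
have T : wt_deg 1 1 G = 1%N by lia.
have s1 : (size (G`_1)%R <= 1)%N.
  apply/leq_sizeP => j j1; apply/eqP; apply: contraTT j1 => /(wt_deg_ge 1 1).
  by rewrite T; lia.
have s0 : (size (G`_0)%R <= 2)%N.
  apply/leq_sizeP => j j1; apply/eqP; apply: contraTT j1 => /(wt_deg_ge 1 1).
  by rewrite T; lia.
have := size1_polyC s1; set e := (G`_1)`_0 => eE.
have e0 : e != 0 by apply: contraNneq G1; rewrite eE => ->.
have g0E y : (G`_0).[y] = (G`_0)`_0 + (G`_0)`_1 * y.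
  by rewrite (horner_coef_wide _ s0) big_ord_recl big_ord1 /= expr0 expr1 mulr1.
set f0 := (G`_0)`_0 in g0E; set f1 := (G`_0)`_1 in g0E.
have le z : (line_ord G z <= 3 * (z.2 == (- f1 / e) * z.1 + (- f0 / e))%R)%N.
  have [//|ne] := eqVneq; rewrite muln0.
  rewrite -[0%N]/(0 + 0)%N -{1}(muln0 k) -(muln0 3%N); apply: wt_ord_le.
  rewrite c0 eE hornerC g0E; apply: contraNneq ne => h; apply/eqP.
  apply: (mulfI e0); rewrite mulrDr [e * (_ / _ * _)]mulrA ![e * (_ / _)]mulrC !divfK //.
  by apply/eqP; rewrite -subr_eq0 -[X in _ == X]h; apply/eqP; ring.
apply: leq_trans (@leq_sum _ q xpredT _ _ (fun z _ => le z)) _.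
rewrite -big_distrr /= T; have := collinear (- f1 / e) (- f0 / e).
by rewrite -sum1_count big_mkcond /= mulnC [(k * _)%N]mulnC; apply: leq_trans; rewrite mulnC.
Qed.

Lemma slope_boundP G : G != 0 -> slope_bound G.
Proof.
have [n] := ubnP (wt_deg 1 1 G + (size G).-1).
elim: n G => // n IHn G; rewrite ltnS => sG G0.
have split P Q : G = P * Q -> (0 < wt_deg 1 1 P + (size P).-1)%N -> (0 < wt_deg 1 1 Q + (size
    Q).-1)%N -> slope_bound G.
  move=> e h1 h2; have P0 : P != 0 by apply: contraNneq G0; rewrite e => ->; rewrite mul0r.
  have Q0 : Q != 0 by apply: contraNneq G0; rewrite e => ->; rewrite mulr0.
  move: sG; rewrite e wt_degM // size_mul // (polySpred P0) (polySpred Q0) /= addnS /= => sG.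
  rewrite addnACA in sG; apply: slope_boundM => //; apply: IHn => //; apply: leq_trans sG.
    by rewrite -[X in (X < _)%N]addn0 ltn_add2l.
  by rewrite -[X in (X < _)%N]add0n ltn_add2r.
have [s1|s1] := leqP (size G) 1.
  have GE := size1_polyC s1; rewrite GE; apply: slope_bound_const.
  by apply: contraNneq G0 => h; rewrite GE h.
have [s2|s2] := eqVneq (size G) 2%N.
  have [cop|] := boolP (coprimep G`_0 G`_1).
    apply: slope_bound_linear => // a; have [/rootP r|//] := eqVneq (G`_0).[a] 0.
    by rewrite (coprimep_root cop r).
  rewrite coprimep_def => /closed_rootP[a ra].
  have rE j : (G`_j).[a] = 0.
    case: j => [|[|j]].
    - by apply/rootP; move: ra; rewrite -!dvdp_XsubCl => /dvdp_trans; apply; apply: dvdp_gcdl.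
    - by apply/rootP; move: ra; rewrite -!dvdp_XsubCl => /dvdp_trans; apply; apply: dvdp_gcdr.
    - by rewrite nth_default ?horner0 // s2.
  have [P PE] := divide_content rE.
  have X0 : ('X - a%:P : {poly K}) != 0 by rewrite polyXsubC_eq0.
  apply: (split ('X - a%:P)%:P P); first by rewrite mul_polyC.
    rewrite addn_gt0; apply/orP; left; apply: (@wt_deg_ge _ 1 1 _ 0%N 1%N).
    by rewrite coefC /= coefB coefX coefC subr0 oner_eq0.
  have := congr1 (fun r : {poly {poly K}} => size r) PE; rewrite s2 size_scale // => <-.
  by rewrite addn_gt0 orbT.
(* In slope degree at least 2, either the discriminant vanishes and [G] factors, or the degree of
   the discriminant is compared with its orders. *)
have [d sGd] : exists d, size G = d.+3.
  by move: s1 s2; case: (size G) => [|[|[|d]]] // _ _; exists d.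
have [/(disc_eq0_factor sGd (ltn0Sn _)) [P [Q [e sP sQ]]]|D0] := eqVneq (disc d.+1 G) 0.
  by apply: (split P Q) => //; rewrite addn_gt0 -subn1 subn_gt0 ?sP ?sQ orbT.
set T := wt_deg 1 1 G.
have hT j : G`_j != 0 -> ((size (G`_j)%R).-1 + j <= T)%N.
  move=> h; have := @wt_deg_ge _ 1 1 G j (size (G`_j)%R).-1.
  by rewrite -lead_coefE lead_coef_eq0 !mul1n => /(_ h).
have T0 : (0 < T)%N.
  apply: leq_trans (hT d.+2 _); first by rewrite addnS.
  by rewrite -[d.+2]/(d.+3.-1) -sGd -lead_coefE lead_coef_eq0.
have degD := disc_degree_le D0 T0 hT.
have ordD z : (2 * d.+1 * line_ord G z <= k * polyord (disc d.+1 G \Po ('X + z.1%:P)) + 3 *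
    (d.+1 * d.+2))%N.
  have DE : disc d.+1 (translate2 z.1 z.2 G) = disc d.+1 G \Po ('X + z.1%:P).
    rewrite /translate2 /= disc_comp ?disc_map //.
    by rewrite (leq_trans (size_poly _ _)) // sGd.
  rewrite -DE; apply: disc_ord_ge => [|j h].
    by rewrite DE comp_poly2_eq0 ?size_XaddC.
  by apply: wt_ord_le; apply: polyord_coef.
rewrite /slope_bound sGd /= -(leq_pmul2l (isT : 0 < 2 * d.+1)%N) big_distrr /=.
apply: leq_trans (@leq_sum _ q xpredT _ _ (fun z _ => ordD z)) _.
rewrite big_split /= -big_distrr /= sum_const_seq -/k.
have := sum_polyord_le D0 uniq1; rewrite big_map; set S := (\sum_(i <- q) _)%N => leS.
(* With [D = d + 1], the right side is [k (2 D T - D (D + 1)) + 3 k D (D + 1) = 2 D k (T + D + 1)],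
   and [D + 1] is the degree of [G] in the slope. *)
apply: leq_trans (_ : k * (2 * d.+1 * T - d.+1 * d.+2) + k * (3 * (d.+1 * d.+2)) <= _)%N.
  rewrite leq_add // leq_mul2l; apply/orP; right; apply: leq_trans leS _.
  by rewrite leq_subRL ?(leq_trans _ degD) ?leq_addl // addnC.
have h : (d.+1 * d.+2 <= 2 * d.+1 * T)%N by apply: leq_trans degD; apply: leq_addl.
rewrite -mulnDr [X in (_ <= X)%N]mulnCA leq_mul2l; apply/orP; right.
by rewrite [(2 * d.+1 * (_ + _))%N]mulnDr; lia.
Qed.

End SlopeBound.

(** * Sections over the incidence variety *)

(** With fewer equations than unknowns the matrix has a nonzero left kernel; the solution is
    extended by zero outside [B]. *)
Lemma linear_system_solution (K : fieldType) (T J : eqType) (B : seq T) (S : seq J)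
    (phi : J -> T -> K) : uniq B -> (size S < size B)%N ->
  exists c : T -> K, [/\ exists2 t, t \in B & c t != 0,
    forall t, t \notin B -> c t = 0 &
    forall j, j \in S -> \sum_(t <- B) c t * phi j t = 0].
Proof.
case: B => // t0 B; set B' := t0 :: B => uB lt.
case: S lt => [|j0 S]; set S' := (X in size X) => lt.
  exists (fun t => (t \in B')%:R); split=> //.
    by exists t0; rewrite ?mem_head ?oner_eq0.
  by move=> t /negPf ->.
pose A := \matrix_(i < size B', j < size S') phi (nth j0 S' j) (nth t0 B' i).
have /rowV0Pn[v /sub_kermxP vA v0] : kermx A != 0.
  rewrite -mxrank_eq0 mxrank_ker subn_eq0 -ltnNge.
  exact: leq_ltn_trans (rank_leq_col _) lt.
exists (fun t => if insub (index t B') is Some i then v 0 i else 0).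
have cE (i : 'I_(size B')) :
    (if insub (index (nth t0 B' i) B') is Some i' then v 0 i' else 0) = v 0 i.
  by rewrite index_uniq // valK.
split.
  have [i vi] := rV0Pn _ v0; exists (nth t0 B' i); first by rewrite mem_nth.
  by rewrite cE.
  by move=> t; rewrite -index_mem => /negPf lt'; rewrite insubF.
move=> j jS; rewrite (big_nth t0) big_mkord.
have lj : (index j S' < size S')%N by rewrite index_mem.
have /rowP/(_ (Ordinal lj)) := vA; rewrite !mxE => h; rewrite -[RHS]h.
by apply: eq_bigr => i _; rewrite cE !mxE /= nth_index.
Qed.

Lemma coef_XaddC_exp (R : comNzRingType) (w : R) j a :
  (('X + w%:P) ^+ j)`_a = w ^+ (j - a) *+ 'C(j, a).
Proof.
rewrite addrC exprDn coef_sum; have [aj|ja] := leqP a j; last first.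
  rewrite bin_small // mulr0n big1 // => i _; rewrite coefMn -polyC_exp coefCM coefXn.
  by case: eqP => [e|_]; rewrite ?mulr0 ?mul0rn //; have := ltn_ord i; lia.
rewrite (bigD1 (Ordinal (aj : (a < j.+1)%N))) //= big1 ?addr0 => [|i ne].
  by rewrite coefMn -polyC_exp coefCM coefXn eqxx mulr1.
rewrite coefMn -polyC_exp coefCM coefXn.
by case: eqP => [e|_]; rewrite ?mulr0 ?mul0rn //; case/eqP: ne; apply/val_inj.
Qed.

Lemma coef_comp_XaddC (R : comNzRingType) (P : {poly R}) (w : R) m a : (size P <= m)%N ->
  (P \Po ('X + w%:P))`_a = \sum_(j < m) P`_j * (w ^+ (j - a) *+ 'C(j, a)).
Proof.
move=> sP; rewrite coef_comp_poly (big_ord_widen _ (fun j => P`_j * (('X + w%:P) ^+ j)`_a) sP).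
rewrite big_mkcond /=; apply: eq_bigr => j _; rewrite coef_XaddC_exp.
by case: ltnP => // h; rewrite nth_default ?mul0r.
Qed.

Section Sections.
Variables (p n : nat).

(** In [(i, b, a)], [i] and [b] are the exponents of [x] and of the slope. The exponent [a] is spent
    first on [y], up to the degree [p - i] left by [x], and then on [C], up to [n - b]. *)
Definition section_basis : seq (nat * nat * nat) :=
  [seq (z.1, z.2, a) | z <- [seq (i, b) | i <- iota 0 p.+1, b <- iota 0 n.+1],
                       a <- iota 0 (p - z.1 + (n - z.2)).+1].

Lemma uniq_section_basis : uniq section_basis.
Proof.
apply: allpairs_uniq_dep.
- by apply: allpairs_uniq; rewrite ?iota_uniq // => -[? ?] [? ?] _ _ [-> ->].
- by move=> *; apply: iota_uniq.
- by move=> [[? ?] ?] [[? ?] ?] _ _ /= [-> -> ->].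
Qed.

Lemma mem_section_basis i b a :
  ((i, b, a) \in section_basis) = [&& (i <= p)%N, (b <= n)%N & (a <= p - i + (n - b))%N].
Proof.
have mi m x : (x \in iota 0 m.+1) = (x <= m)%N by rewrite mem_iota add0n ltnS.
apply/allpairsPdep/and3P => [[[i' b'] [a' [/allpairsPdep[i2 [b2 [h1 h2 [-> ->]]]] h3 [-> ->
    ->]]]]|[h1 h2 h3]].
  by move: h1 h2 h3; rewrite !mi.
exists (i, b), a; split; rewrite ?mi //.
by apply/allpairsPdep; exists i, b; split; rewrite ?mi.
Qed.

(* A section of [O(p, n)] over the incidence variety in the chart of points
   [(x, y)] and lines [Y = M X + C] through them, so that [C = y - M x]. *)
Section Eval.
Variables (K B : comNzRingType) (iota : {rmorphism K -> B}) (c : nat * nat * nat -> K).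

Definition section_monomial (X Y M : B) (t : nat * nat * nat) :=
  let: (i, b, a) := t in
  X ^+ i * Y ^+ minn a (p - i) * (Y - M * X) ^+ (a - (p - i)) * M ^+ b.

Definition section_eval (X Y M : B) := \sum_(t <- section_basis) iota (c t) * section_monomial
    X Y M t.

End Eval.

Lemma section_eval_morph (K B B' : comNzRingType) (io : {rmorphism K -> B}) (io' : {rmorphism K
    -> B'})
    (f : {rmorphism B -> B'}) c X Y M : (forall x, f (io x) = io' x) ->
  f (section_eval io c X Y M) = section_eval io' c (f X) (f Y) (f M).
Proof.
move=> h; rewrite rmorph_sum; apply: eq_bigr => -[[i b] a] _.
by rewrite !rmorphM !rmorphXn rmorphB rmorphM h.
Qed.

Section Lowest.
Variables (K B : comNzRingType) (io : {rmorphism K -> B}) (c : nat * nat * nat -> K).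
Variable s : nat.
Hypothesis low : forall i b a, (i < s)%N -> c (i, b, a) = 0.

Definition slice (Y M : B) :=
  \sum_(t <- section_basis | t.1.1 == s) io (c t) * (Y ^+ t.2 * M ^+ t.1.2).

(* Since [C = y] on [x = 0], the lowest coefficient in [x] has the monomial basis. *)
Lemma section_eval_lowest X Y M : exists Z, section_eval io c X Y M = X ^+ s * (slice Y M + X *
    Z).
Proof.
have term t : exists Z, io (c t) * section_monomial X Y M t =
    X ^+ s * ((if t.1.1 == s then io (c t) * (Y ^+ t.2 * M ^+ t.1.2) else 0) + X * Z).
  have CE l : exists Z, (Y - M * X) ^+ l = Y ^+ l + X * Z.
    elim: l => [|l [Z IHl]]; first by exists 0; rewrite !expr0 mulr0 addr0.
    by exists (Y * Z - M * Y ^+ l - M * X * Z); rewrite exprS IHl exprS; ring.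
  case: t => [[i b] a] /=; have [lt|gt|->] := ltngtP i s.
  - by exists 0; rewrite low // rmorph0 !(mul0r, mulr0, addr0).
  - exists (io (c (i, b, a)) * (X ^+ (i - s.+1) * Y ^+ minn a (p - i) *
      (Y - M * X) ^+ (a - (p - i)) * M ^+ b)).
    have -> : X ^+ i = X ^+ s * X * X ^+ (i - s.+1) by rewrite -exprSr -exprD subnKC.
    by ring.
  - have [Z CZ] := CE (a - (p - s))%N; exists (io (c (s, b, a)) * Y ^+ minn a (p - s) * Z * M
      ^+ b).
    have -> : Y ^+ a = Y ^+ minn a (p - s) * Y ^+ (a - (p - s)).
      by rewrite -exprD minnE subnK // leq_subr.
    by rewrite CZ; ring.
rewrite /section_eval /slice; elim: section_basis => [|t r [Z IHr]]; first by exists 0; rewrite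
    !big_nil; ring.
have [Z' E] := term t; exists (Z' + Z); rewrite !big_cons IHr E.
by case: ifP => _; ring.
Qed.

End Lowest.
End Sections.

(** * Degrees in an inner variable of iterated polynomials *)

Section CoefDeg.
Variable R : comNzRingType.
Implicit Types A B : {poly {poly R}}.

Definition coefdeg e A := forall j, (size (A`_j)%R <= e.+1)%N.

Lemma coefdegW e e' A : (e <= e')%N -> coefdeg e A -> coefdeg e' A.
Proof. by move=> le h j; apply: leq_trans (h j) _. Qed.

Lemma coefdegD e A B : coefdeg e A -> coefdeg e B -> coefdeg e (A + B).
Proof. by move=> hA hB j; rewrite coefD (leq_trans (size_polyD _ _)) // geq_max hA hB. Qed.

Lemma coefdeg_sum e (I : Type) (r : seq I) (P : pred I) (F : I -> {poly {poly R}}) :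
  (forall i, P i -> coefdeg e (F i)) -> coefdeg e (\sum_(i <- r | P i) F i).
Proof.
move=> h; apply: big_ind => //; last exact: coefdegD.
by move=> j; rewrite coef0 size_poly0.
Qed.

Lemma coefdegN e A : coefdeg e A -> coefdeg e (- A).
Proof. by move=> hA j; rewrite coefN size_polyN. Qed.

Lemma coefdegM e f A B : coefdeg e A -> coefdeg f B -> coefdeg (e + f) (A * B).
Proof.
move=> hA hB j; rewrite coefM; apply: (leq_trans (size_sum _ _ _)).
apply/bigmax_leqP => i _; apply: (leq_trans (size_polyMleq _ _)).
by have := leq_add (hA i) (hB (j - i)%N); rewrite addSn addnS; case: (_ + _)%N.
Qed.

Lemma coefdegC e (r : {poly R}) : (size r <= e.+1)%N -> coefdeg e r%:P.
Proof. by move=> h j; rewrite coefC; case: eqP; rewrite ?size_poly0. Qed.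

Lemma coefdegX : coefdeg 0 'X.
Proof. by move=> j; rewrite coefX; case: eqP; rewrite ?size_poly1 ?size_poly0. Qed.

Lemma coefdegXn e A m : coefdeg e A -> coefdeg (m * e) (A ^+ m).
Proof.
move=> hA; elim: m => [|m IHm]; first by rewrite expr0; apply: coefdegC; rewrite size_poly1.
by rewrite exprS mulSn; apply: coefdegM.
Qed.

End CoefDeg.

(* The coefficients that extract, in [at_line_size], a single coefficient of a
   section along a line from those in the coordinates where its degree is seen. *)
Lemma alternating_Vandermonde a N B : (a <= N)%N ->
  \sum_(t < B.+1) (-1) ^+ t *+ 'C(a, t) *+ 'C(N - t, B - t) = ('C(N - a, B))%:R :> int.
Proof.
elim: a N B => [|a IHa] N B aN.
  rewrite big_ord_recl /= bin0 !subn0 big1 ?addr0 // => i _.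
  by rewrite bin0n mulr0n mul0rn.
case: N aN => // N; rewrite ltnS => aN; rewrite subSS.
have [->|B0] := posnP B; first by rewrite big_ord1 !bin0.
have split t : (-1) ^+ t *+ 'C(a.+1, t) *+ 'C(N.+1 - t, B - t) =
   (-1) ^+ t *+ 'C(a, t) *+ 'C(N.+1 - t, B - t) +
   (if t is t'.+1 then - ((-1) ^+ t' *+ 'C(a, t') *+ 'C(N - t', B.-1 - t')) else 0) :> int.
  case: t => [|t]; first by rewrite !bin0 addr0.
  rewrite binS mulrnDr mulrnDl subSS; congr (_ + _).
  by rewrite exprS mulN1r !mulNrn -subn1 -subnDA add1n.
under eq_bigr => t _ do rewrite split.
rewrite big_split /= IHa ?(leqW aN) //.
rewrite [X in _ + X]big_ord_recl /= add0r sumrN -(prednK B0) /=.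
rewrite IHa // subSn // binS natrD addrK //.
Qed.

Section CoefDeg2.
Variable R : comNzRingType.
Implicit Types A B : {poly {poly {poly R}}}.

Definition coefdeg2 e A := forall j, coefdeg e A`_j.

Lemma coefdeg2W e e' A : (e <= e')%N -> coefdeg2 e A -> coefdeg2 e' A.
Proof. by move=> le h j; apply: coefdegW (h j). Qed.

Lemma coefdeg2C e (r : {poly {poly R}}) : coefdeg e r -> coefdeg2 e r%:P.
Proof. by move=> h j; rewrite coefC; case: eqP => // _ i; rewrite coef0 size_poly0. Qed.

Lemma coefdeg2D e A B : coefdeg2 e A -> coefdeg2 e B -> coefdeg2 e (A + B).
Proof. by move=> hA hB j; rewrite coefD; apply: coefdegD. Qed.

Lemma coefdeg2_sum e (I : Type) (r : seq I) (P : pred I) (F : I -> {poly {poly {poly R}}}) :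
  (forall i, P i -> coefdeg2 e (F i)) -> coefdeg2 e (\sum_(i <- r | P i) F i).
Proof. by move=> h j; rewrite coef_sum; apply: coefdeg_sum => i Pi; apply: h. Qed.

Lemma coefdeg2M e f A B : coefdeg2 e A -> coefdeg2 f B -> coefdeg2 (e + f) (A * B).
Proof. by move=> hA hB j; rewrite coefM; apply: coefdeg_sum => i _; apply: coefdegM. Qed.

Lemma coefdeg2Xn e A m : coefdeg2 e A -> coefdeg2 (m * e) (A ^+ m).
Proof.
move=> hA; elim: m => [|m IHm]; last by rewrite exprS mulSn; apply: coefdeg2M.
by rewrite expr0; apply/coefdeg2C/coefdegC; rewrite size_poly1.
Qed.

Lemma coefdeg2X : coefdeg2 0 'X.
Proof.
move=> j; rewrite coefX; case: eqP => _; first by apply: coefdegC; rewrite size_poly1.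
by move=> i; rewrite coef0 size_poly0.
Qed.

End CoefDeg2.

(** * Vanishing of sections at points and along lines *)

Section Vanish.
Variable K : numClosedFieldType.
Variables (p n : nat).
Variable c : nat * nat * nat -> K.
Notation W := {poly {poly {poly K}}}.

Definition cst : K -> W := polyC \o polyC \o polyC.
HB.instance Definition _ := GRing.RMorphism.on cst.

(** Variables from the outermost: offset in [y], slope, offset in [x]. *)
Definition at_point (z : K * K) : W :=
  section_eval p n cst c ('X + z.1%:P)%:P%:P ('X + z.2%:P%:P%:P) ('X%:P).

(** Variables from the outermost: vertical distance to the line, slope relative to that of the line,
    [x]. *)
Definition at_line (l : K * K) : W :=
  section_eval p n cst c 'X%:P%:P ('X + (l.2%:P * 'X + l.1%:P)%:P%:P) ('X + l.2%:P%:P)%:P.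

Lemma at_point_mdeg z : coefdeg n (at_point z).
Proof.
rewrite /at_point /section_eval big_seq; apply: coefdeg_sum => -[[i b] a].
rewrite mem_section_basis => /and3P[hi hb ha]; rewrite /section_monomial.
have hX : coefdeg 0 (('X + z.1%:P)%:P%:P : W) by apply: coefdegC; rewrite size_polyC leq_b1.
have hY : coefdeg 0 ('X + z.2%:P%:P%:P : W).
  by apply: coefdegD; [exact: coefdegX | apply: coefdegC; rewrite size_polyC leq_b1].
have hM : coefdeg 1 ('X%:P : W) by apply: coefdegC; rewrite size_polyX.
have hC := coefdegD (coefdegW (leq0n 1) hY) (coefdegN (coefdegM hM hX)).
apply: coefdegW (coefdegM (_ : coefdeg 0 _) (coefdegM (coefdegM (coefdegM (coefdegXn _ hX)
    (coefdegXn _ hY)) (coefdegXn _ hC)) (coefdegXn _ hM))).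
  by rewrite !muln0 !muln1 !add0n; lia.
by apply: coefdegC; rewrite size_polyC leq_b1.
Qed.

Lemma poly2_divXn (A : {poly {poly K}}) e : (forall b i, (i < e)%N -> A`_b`_i = 0) ->
  exists A', A = ('X^e)%:P * A'.
Proof.
move=> h; exists (map_poly (drop_poly e) A); apply/polyP => b.
rewrite coefCM coef_map /= mulrC -[LHS](poly_take_drop e) [take_poly _ _](_ : _ = 0) ?add0r //.
by apply/polyP => i; rewrite coef_take_poly coef0; case: ifP => // /h.
Qed.

(** The two charts differ by a linear substitution, which preserves the total order in the two
    offsets. The coefficient of degree [a] in the transversal one thus keeps order at least [h - a]
    in [x]. *)
Lemma at_point_line z l h : z.2 = l.2 * z.1 + l.1 ->
  (forall i b j, (i + j < h)%N -> (b <= n)%N -> (at_point z)`_j`_b`_i = 0) ->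
  forall a b i, (i + a < h)%N -> ((at_line l)`_a`_b \Po ('X + z.1%:P))`_i = 0.
Proof.
move=> zl hz a b i lt.
pose w : {poly {poly K}} := (l.2%:P * 'X)%:P.
have E : map_poly (map_poly (comp_poly ('X + z.1%:P))) (at_line l) =
   (map_poly (comp_poly ('X + l.2%:P%:P)) (at_point z)) \Po ('X + w%:P).
  rewrite /at_line /at_point.
  rewrite (@section_eval_morph _ _ _ _ _ cst cst (map_poly (map_poly (comp_poly ('X +
      z.1%:P))))); last first.
    by move=> x; rewrite /cst /=; do ?rewrite map_polyC /=; rewrite comp_polyC.
  rewrite (@section_eval_morph _ _ _ _ _ cst cst (map_poly (comp_poly ('X + l.2%:P%:P)))); last
      first.
    by move=> x; rewrite /cst /= map_polyC /= comp_polyC.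
  rewrite (@section_eval_morph _ _ _ _ _ cst cst (comp_poly ('X + w%:P))); last first.
    by move=> x; rewrite /cst /= comp_polyC.
  congr (section_eval _ _ _ _ _ _ _).
  - by do ?rewrite ?(map_polyC, comp_polyC, comp_polyX) /=.
  - do ?rewrite ?(rmorphD, map_polyC, map_polyX, comp_polyC, comp_polyX) /=.
    rewrite -addrA; congr (_ + _); rewrite -!polyCD; congr (_%:P%:P).
    rewrite comp_polyM !comp_polyC comp_polyX zl polyCD polyCM; ring.
  - by do ?rewrite ?(rmorphD, map_polyC, map_polyX, comp_polyC, comp_polyX) /=.
have := congr1 (fun A : W => A`_a`_b`_i) E; rewrite !coef_map /= => ->.
rewrite (coef_comp_XaddC _ _ (leqnn _)) !coef_sum big1 // => j _.
rewrite coef_map /=; have [ja|aj] := ltnP j a.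
  by rewrite bin_small // mulr0n mulr0 !coef0.
have [|A' ->] := @poly2_divXn (at_point z)`_j (h - j)%N.
  move=> b' i' lt'; have [bn|nb] := leqP b' n; first by apply: hz => //; lia.
  by rewrite [_`_b']nth_default ?coef0 // (leq_trans (at_point_mdeg _ _)).
rewrite comp_polyM comp_polyC mulrnAr !coefMn.
rewrite [w ^+ _](_ : _ = ('X^(j - a))%:P * (l.2%:P ^+ (j - a))%:P); last first.
  by rewrite -polyCM -exprMn ['X * _]mulrC polyC_exp.
rewrite mulrACA -polyCM -exprD coefCM mulrC coefMXn.
by case: ltnP => [_|h']; [rewrite mul0rn | lia].
Qed.


Let v : {poly {poly K}} := 'X * 'X%:P.

(* Substituting [y - M x = C] makes the degree in [x] visible. *)
Lemma at_line_comp l : coefdeg2 p (at_line l \Po ('X + v%:P)).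
Proof.
pose V : W := 'X + v%:P; rewrite -/V /at_line (@section_eval_morph p n K W W cst cst (comp_poly
    V)); last first.
  by move=> x; rewrite /cst /= comp_polyC.
rewrite rmorphD /= !comp_polyC comp_polyX /V.
rewrite /section_eval big_seq; apply: coefdeg2_sum => -[[i b] a].
rewrite mem_section_basis => /and3P[hi hb ha]; rewrite /section_monomial.
have hX : coefdeg2 1 ('X%:P%:P : W) by apply/coefdeg2C/coefdegC; rewrite size_polyX.
have hM : coefdeg2 0 (('X + l.2%:P%:P)%:P : W).
  by apply/coefdeg2C/coefdegD; [exact: coefdegX | apply: coefdegC; rewrite size_polyC leq_b1].
have hl : coefdeg2 0 (l.1%:P%:P%:P : W) by apply/coefdeg2C/coefdegC; rewrite size_polyC leq_b1.
have CE : 'X + v%:P + (l.2%:P * 'X + l.1%:P)%:P%:P - ('X + l.2%:P%:P)%:P * 'X%:P%:P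
    = 'X + l.1%:P%:P%:P :> W.
  rewrite /v !polyCM !polyCD !polyCM; ring.
have YE : 'X + v%:P + (l.2%:P * 'X + l.1%:P)%:P%:P
   = ('X + l.2%:P%:P)%:P * 'X%:P%:P + ('X + l.1%:P%:P%:P) :> W by rewrite -CE; ring.
have hC : coefdeg2 0 ('X + l.1%:P%:P%:P : W) by apply: coefdeg2D => //; exact: coefdeg2X.
have hY : coefdeg2 1 ('X + v%:P + (l.2%:P * 'X + l.1%:P)%:P%:P : W).
  by rewrite YE; apply: coefdeg2D; [exact: coefdeg2M hM hX | exact: coefdeg2W hC].
rewrite CE.
apply: coefdeg2W (coefdeg2M (_ : coefdeg2 0 _) (coefdeg2M (coefdeg2M (coefdeg2M (coefdeg2Xn _
    hX) (coefdeg2Xn _ hY)) (coefdeg2Xn _ hC)) (coefdeg2Xn _ hM))).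
  by rewrite !muln0 !muln1 !add0n !addn0; have := geq_minr a (p - i); lia.
by apply/coefdeg2C/coefdegC; rewrite size_polyC leq_b1.
Qed.

(** After the substitution of [at_line_comp] all degrees in [x] are at most [p]. A combination of
    the [x^t H_(t, N - t)] with [t <= b] equals [x^a P_(a, b)], which thus has degree at most
    [p + b]. *)
Lemma at_line_size l a b : (at_line l)`_a`_b != 0 ->
  (forall a' b', (a' < a)%N -> (a' + b' = a + b)%N -> (at_line l)`_a'`_b' = 0) ->
  (size ((at_line l)`_a`_b)%R + a <= p.+1 + b)%N.
Proof.
move=> q0 h0; set P := at_line l in q0 h0 *; pose N := (a + b)%N.
pose H := P \Po ('X + v%:P).
pose L t : int := (-1) ^+ t *+ 'C(N - t, b - t).
have HE t : (t <= b)%N -> H`_t`_(N - t) =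
   \sum_(j < size P) (if (j <= N)%N then P`_j`_(N - j) * 'X^(j - t) *+ 'C(j, t) else 0).
  move=> tb; rewrite (coef_comp_XaddC _ _ (leqnn _)) coef_sum; apply: eq_bigr => j _.
  have [jt|tj] := ltnP j t.
    by rewrite bin_small // !mulr0n mulr0 coef0; case: ifP.
  rewrite mulrnAr coefMn /v exprMn -polyC_exp mulrA coefMC coefMXn.
  have -> : (N - t < j - t)%N = ~~ (j <= N)%N by rewrite -ltnNge; apply/idP/idP; lia.
  case: ifP => jN; first by rewrite (negPf jN) mul0r mul0rn.
  by move/negbFE: jN => jN; rewrite jN (_ : N - t - (j - t) = N - j)%N //; lia.
have key : 'X^a * P`_a`_b = \sum_(t < b.+1) (L t)%:~R * 'X^t * H`_t`_(N - t).
  (* The binomial ['C(N - j, b)] vanishes for [j > a], and the terms with [j < a] vanish by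
     hypothesis. *)
  transitivity (\sum_(j < size P) (if (j <= N)%N then P`_j`_(N - j) * 'X^j *+ 'C(N - j, b) else
      0)).
    have [ha|ha] := ltnP a (size P); last first.
      rewrite [P`_a]nth_default // coef0 mulr0 big1 // => j _; case: ifP => // jN.
      by rewrite h0 ?mul0r ?mul0rn //; have := ltn_ord j; lia.
    rewrite (bigD1 (Ordinal ha)) //= big1 ?addr0.
      by rewrite leq_addr addKn binn mulrC.
    move=> j ne; case: ifP => // jN; have [ja|aj] := ltnP j a.
      by rewrite h0 ?mul0r ?mul0rn //; lia.
    rewrite bin_small ?mulr0n //.
    have : (j != a :> nat) by apply: contraNneq ne => e; apply/eqP/val_inj.
    by lia.
  under [RHS]eq_bigr => t _ do rewrite (HE _ (ltn_ord t : (t <= b)%N)) big_distrr /=.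
  rewrite exchange_big /=; apply: eq_bigr => j _; case: ifP => jN; last first.
    by rewrite big1 // => t _; rewrite mulr0.
  have := congr1 (fun x : int => x%:~R : {poly K}) (alternating_Vandermonde b jN).
  rewrite rmorph_sum /= => e; rewrite -mulr_natr -[X in _ * X]mulrz_nat -e big_distrr /=.
  apply: eq_bigr => t _; have [jt|tj] := ltnP j t.
    by rewrite bin_small // !mulr0n mul0rn mulr0z !mulr0.
  rewrite -mulrnAC !rmorphMn /= -/(L t) -(subnK tj) exprD addnK.
  by rewrite -!mulrnAr; ring.
have sz : (size ('X^a * P`_a`_b)%R <= p.+1 + b)%N.
  rewrite key; apply: leq_trans (size_sum _ _ _) _; apply/bigmax_leqP => t _.
  rewrite -(rmorph_int (@polyC K)) mul_polyC -scalerAl.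
  apply: leq_trans (size_scale_leq _ _) (leq_trans (size_polyMleq _ _) _).
  rewrite size_polyXn addSn /= addnC leq_add //; first exact: at_line_comp.
  by rewrite -ltnS.
by move: sz; rewrite mulrC size_Mmonic ?monicXn // size_polyXn addnS.
Qed.

(** A nonzero coefficient would have degree at most [p + b - a], but its zeros at the points
    together with that at [x = 0] have total order at least [p + 1 + b - a]. *)
Lemma at_line_vanish k l (pts : seq (K * K)) (h : K * K -> nat) : (3 <= k)%N ->
  uniq pts -> (forall z, z \in pts -> z.2 = l.2 * z.1 + l.1 /\ z.1 != 0) ->
  (forall z, z \in pts -> forall i b j, (i + j < h z)%N -> (b <= n)%N ->
     (at_point z)`_j`_b`_i = 0) ->
  (forall a b s, (k * a + 3 * b < 3 * n)%N ->
     (s < p.+1 + b - a - \sum_(z <- pts) (h z - a))%N -> (at_line l)`_a`_b`_s = 0) ->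
  forall a b, (k * a + 3 * b < 3 * n)%N -> (at_line l)`_a`_b = 0.
Proof.
move=> k3 upts onl hpt hln; elim/ltn_ind => a IHa b lt.
apply/eqP/negPn/negP => q0; set q := (at_line l)`_a`_b in q0.
have sq : (size q + a <= p.+1 + b)%N.
  apply: at_line_size => // a' b' a'a e; apply: IHa => //.
  (* Since [3 <= k], lowering [a] at constant [a + b] does not raise [k a + 3 b], so the induction
     hypothesis applies. *)
  have : (k * a = k * a' + k * (a - a'))%N by rewrite -mulnDr subnKC // ltnW.
  have : (3 * (a - a') <= k * (a - a'))%N by rewrite leq_mul2r k3 orbT.
  lia.
have ux : uniq (0 :: [seq z.1 | z <- pts]).
  rewrite /= map_inj_in_uniq ?upts ?andbT.
    by apply/mapP => -[z zp e]; have [_] := onl z zp; rewrite -e eqxx.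
  move=> [x y] [x' y'] zp zp' /= e; have [/= -> _] := onl _ zp; have [/= -> _] := onl _ zp'.
  by rewrite e.
have := sum_polyord_le q0 ux; rewrite big_cons big_map => le.
have le1 : (p.+1 + b - a - \sum_(z <- pts) (h z - a) <= polyord (q \Po ('X + 0%:P)))%N.
  rewrite addr0 comp_polyXr; apply: polyord_ge => // s; exact: hln.
have le2 : (\sum_(z <- pts) (h z - a) <= \sum_(z <- pts) polyord (q \Po ('X + z.1%:P)))%N.
  rewrite big_seq [leqRHS]big_seq; apply: leq_sum => z zp.
  apply: polyord_ge => [|i hi]; first by rewrite comp_poly2_eq0 ?size_XaddC.
  have [zl _] := onl z zp; apply: (at_point_line zl (hpt z zp)); lia.
have q1 : (0 < size q)%N by rewrite size_poly_gt0.
have := leq_trans (leq_add le1 le2) le; move: sq q1.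
move: (size q) (\sum_(z <- pts) _)%N => x y; lia.
Qed.

Lemma slice_morph (B B' : comNzRingType) (io : {rmorphism K -> B}) (io' : {rmorphism K -> B'})
    (f : {rmorphism B -> B'}) s Y M : (forall x, f (io x) = io' x) ->
  f (slice p n io c s Y M) = slice p n io' c s (f Y) (f M).
Proof.
move=> h; rewrite rmorph_sum; apply: eq_bigr => -[[i b] a] _.
by rewrite !rmorphM !rmorphXn h.
Qed.

Hypothesis n0 : (0 < n)%N.
Hypothesis np : (n <= p)%N.
Hypothesis c_off : forall t, t \notin section_basis p n -> c t = 0.
Hypothesis c_neq0 : exists2 t, t \in section_basis p n & c t != 0.

Definition cst2 : K -> {poly {poly K}} := polyC \o polyC.
HB.instance Definition _ := GRing.RMorphism.on cst2.

(** The lowest coefficient [g] in [x] is a nonzero polynomial in position and slope, divisible by a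
    power of [y] because of the order at the origin. The quotient has total degree at most [2 n - 1]
    and slope degree at most [n], so by [slope_boundP] its orders add up to at most [k (3 n - 1)],
    whereas each of the [k] lines requires [3 n]. *)
Lemma sections_vanish (q : seq (K * K)) : (3 <= size q)%N ->
  uniq [seq l.1 | l <- q] -> (forall l, l \in q -> l.1 != 0) ->
  (forall a b : K, (3 * count (fun l => l.2 == a * l.1 + b)%R q <= 2 * size q)%N) ->
  (forall i b j, (i + j <= p - n)%N -> (b <= n)%N -> (at_point (0, 0))`_j`_b`_i = 0) ->
  (forall l, l \in q -> forall a b, (size q * a + 3 * b < 3 * n)%N -> (at_line l)`_a`_b = 0) ->
  False.
Proof.
move=> k3 uq q_neq0 coll horig hline.
have exs : exists s, has (fun t => (t.1.1 == s) && (c t != 0)) (section_basis p n).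
  have [t tb ct] := c_neq0; exists t.1.1; apply/hasP; exists t => //.
  by rewrite eqxx.
have [s hs mins] := find_ex_minn exs.
have low i b a : (i < s)%N -> c (i, b, a) = 0.
  move=> lt; have [tb|/c_off//] := boolP ((i, b, a) \in section_basis p n).
  apply/eqP; apply: contraTT lt => ct; rewrite -leqNgt; apply: mins.
  by apply/hasP; exists (i, b, a); rewrite ?eqxx.
pose g : {poly {poly K}} := slice p n cst2 c s 'X%:P 'X.
have gE b a : g`_b`_a = c (s, b, a).
  rewrite /g /slice coef_sum coef_sum.
  have term t : (cst2 (c t) * ('X%:P ^+ t.2 * 'X ^+ t.1.2))`_b`_a =
     c t *+ ((a == t.2) && (b == t.1.2)).
    rewrite /cst2 /= coefCM -polyC_exp coefCM coefXn coefCM.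
    case: (b == _); rewrite ?andbF ?mulr0 ?coef0 ?mulr0 // mulr1 coefXn andbT.
    by case: (a == _); rewrite ?mulr0 ?mulr1.
  under eq_bigr => t _ do rewrite term.
  have off t : t != (s, b, a) -> (if t.1.1 == s then c t *+ ((a == t.2) && (b == t.1.2)) else
      0) = 0.
    case: t => [[i' b'] a'] /=; rewrite !xpair_eqE [a == a']eq_sym [b == b']eq_sym.
    by case: (i' == s); case: (b' == b); case: (a' == a).
  rewrite big_mkcond /=; have [tb|tb] := boolP ((s, b, a) \in section_basis p n).
    rewrite (bigD1_seq (s, b, a)) ?uniq_section_basis //= !eqxx big1 ?addr0 // => t; exact: off.
  rewrite (c_off tb) big_seq big1 // => t tin; apply: off.
  by apply: contraNneq tb => <-.
have gbasis b a : g`_b`_a != 0 -> [&& (s <= p)%N, (b <= n)%N & (a <= p - s + (n - b))%N].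
  rewrite gE -mem_section_basis => h; apply: contraNT h => /c_off ->; exact: eqxx.
have g0 : g != 0.
  move/hasP: hs => [[[i b] a] _ /= /andP[/eqP -> ct]].
  by apply: contraNneq ct => g0; rewrite -gE g0 !coef0.
have shC (y m x : K) : translate2 y m x%:P%:P = x%:P%:P.
  by rewrite /translate2 /= map_polyC /= !comp_polyC.
have swC (x : K) : swapXY (x%:P%:P) = x%:P%:P.
  apply/polyP => i; apply/polyP => j; rewrite coef_swapXY !coefC.
  by case: i j => [|i] [|j]; rewrite ?coefC ?coef0.
have shX (y m : K) : translate2 y m 'X = 'X + m%:P%:P.
  by rewrite /translate2 /= map_polyX comp_polyX.
have shY (y m : K) : translate2 y m 'X%:P = ('X + y%:P)%:P.
  by rewrite /translate2 /= map_polyC /= comp_polyC comp_polyX.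
have swX : swapXY ('X : {poly {poly K}}) = 'X%:P by apply: swapXY_X.
have swY : swapXY ('X%:P : {poly {poly K}}) = 'X by apply: swapXY_Y.
(* This sets [x = 0]. The two remaining variables of the charts are nested in the order opposite to
   that in [g], whence [swapXY]. *)
pose e0 : W -> {poly {poly K}} := map_poly (map_poly (horner_eval 0)).
have lowE (Y M : W) (j b : nat) : (@section_eval p n K W cst c ('X%:P%:P : W) Y M)`_j`_b`_s =
    (@slice p n K {poly {poly K}} cst2 c s (e0 Y) (e0 M))`_j`_b.
  have [Z ->] := @section_eval_lowest p n K W cst c s low ('X%:P%:P : W) Y M.
  rewrite -!polyC_exp coefCM coefCM coefXnM ltnn subnn -horner_coef0.
  rewrite -[LHS]/(horner_eval 0 _) -coef_map -coef_map /=.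
  rewrite rmorphD rmorphM /= map_polyC /= map_polyC /= horner_evalE hornerX mul0r addr0.
  rewrite (@slice_morph W {poly {poly K}} cst cst2 (map_poly (map_poly (horner_eval 0)))) //.
  by move=> x; rewrite /cst /cst2 /= map_polyC /= map_polyC /= horner_evalE hornerC.
have gorig b a : (s + a <= p - n)%N -> g`_b`_a = 0.
  move=> sa; have [bn|nb] := leqP b n; last first.
    by apply/eqP; apply: contraTT nb => /gbasis/and3P[_ + _]; rewrite -leqNgt.
  have := horig s b a sa bn; rewrite /at_point /= !addr0 lowE.
  rewrite [slice _ _ _ _ _ _ _](_ : _ = swapXY g) ?coef_swapXY //.
  rewrite /e0 map_polyX map_polyC /= map_polyX.
  rewrite /g (@slice_morph {poly {poly K}} {poly {poly K}} cst2 cst2 swapXY).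
    by congr (slice _ _ _ _ _ _ _); apply/esym; [exact: swapXY_Y | exact: swapXY_X].
  by move=> x; apply: swC.
have gline l : l \in q -> forall b a, (size q * a + 3 * b < 3 * n)%N -> (translate2 l.1 l.2
    g)`_b`_a = 0.
  move=> lq b a lt; have := hline l lq a b lt.
  move/(congr1 (fun r : {poly K} => r`_s)); rewrite coef0 /at_line lowE.
  rewrite [slice _ _ _ _ _ _ _](_ : _ = swapXY (translate2 l.1 l.2 g)) ?coef_swapXY // /g.
  rewrite (@slice_morph {poly {poly K}} {poly {poly K}} cst2 cst2 (translate2 l.1 l.2)); last
      first.
    by move=> x; apply: shC.
  rewrite (@slice_morph {poly {poly K}} {poly {poly K}} cst2 cst2 swapXY); last first.
    by move=> x; apply: swC.
  congr (slice _ _ _ _ _ _ _).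
    rewrite -[RHS]/(swapXY (translate2 l.1 l.2 'X%:P)) shY (etrans (congr1 swapXY (polyCD _ _))
        (etrans (rmorphD swapXY _ _) (congr2 +%R swY (swC _)))).
    rewrite /e0 rmorphD /= map_polyX map_polyC /= map_polyC /= horner_evalE.
    by rewrite hornerD hornerM !hornerC hornerX mulr0 add0r.
  rewrite -[RHS]/(swapXY (translate2 l.1 l.2 'X)) shX (etrans (rmorphD swapXY _ _) (congr2 +%R
      swX (swC _))).
  by rewrite /e0 map_polyC /= rmorphD /= map_polyX map_polyC /= horner_evalE hornerC polyCD.
(* Division by [y^e] leaves total degree at most [2 n - 1], also when [p - n < s] and [e] is
   truncated to 0. *)
pose e := ((p - n).+1 - s)%N.
have [|g' gg'] := @poly2_divXn g e.
  by move=> b i ie; apply: gorig; rewrite /e in ie; lia.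
have g'0 : g' != 0 by apply: contraNneq g0 => h; rewrite gg' h mulr0.
have g'E b a : g'`_b`_a = g`_b`_(a + e).
  by rewrite gg' coefCM coefXnM ltnNge leq_addl addnK.
have T : (wt_deg 1 1 g' <= 2 * n - 1)%N.
  by apply: wt_deg_le => b a; rewrite g'E => /gbasis/and3P[]; rewrite /e; lia.
have nu : ((size g').-1 <= n)%N.
  suff : (size g' <= n.+1)%N by case: (size g').
  apply/leq_sizeP => b nb; apply/polyP => a; rewrite g'E coef0.
  by apply/eqP; apply: contraTT nb => /gbasis/and3P[_ bn _]; rewrite -ltnNge ltnS.
have := slope_boundP uq coll g'0; rewrite /slope_bound.
have le l : l \in q -> (3 * n <= line_ord q g' l)%N.
  move=> lq; have X0 : ('X^e)%:P != 0 :> {poly {poly K}} by rewrite polyC_eq0 monic_neq0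
      ?monicXn.
  have : (3 * n <= line_ord q g l)%N.
    apply: wt_ord_ge; first by rewrite translate2_eq0.
    by move=> b a; apply: gline.
  (* No line passes through the origin, so [y^e] has order 0 along each of them. *)
  rewrite gg' line_ordM // (_ : line_ord q _ l = 0)%N ?add0n //.
  have h : (translate2 l.1 l.2 ('X^e)%:P)`_0`_0 != 0.
    rewrite /translate2 /= map_polyC /= comp_polyC coefC /= comp_Xn_poly.
    by rewrite -horner_coef0 horner_exp hornerD hornerX hornerC add0r expf_neq0 // q_neq0.
  by have := wt_ord_le (size q) 3 h; rewrite !muln0 leqn0 => /eqP.
have : (size q * (3 * n) <= \sum_(z <- q) line_ord q g' z)%N.
  by rewrite -sum_const_seq big_seq [leqRHS]big_seq; apply: leq_sum.
move=> h1 h2; have := leq_trans h1 h2; rewrite leq_mul2l => /orP[|]; first by case: (size q) k3.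
by move=> h3; have := leq_trans h3 (leq_add T nu); move: n0; clear; lia.
Qed.

End Vanish.

(** * Counting conditions *)

Lemma size_allpairs_dep_sum (S T U : Type) (f : S -> T -> U) (s : seq S) (t : S -> seq T) :
  size [seq f x y | x <- s, y <- t x] = (\sum_(x <- s) size (t x))%N.
Proof. by rewrite size_allpairs_dep sumnE big_map. Qed.

Lemma sum_rev (m : nat) : (\sum_(0 <= i < m) (m - i) * 2 = m * m.+1)%N.
Proof.
elim: m => [|m IHm]; first by rewrite big_geq.
rewrite big_nat_recl //= subn0.
have -> : (\sum_(0 <= i < m) (m.+1 - i.+1) * 2 = m * m.+1)%N.
  by rewrite -IHm; apply: eq_big_nat => i _; rewrite subSS.
lia.
Qed.

(** Twice the Weyl dimension [(p + 1) (n + 1) (p + n + 2) / 2] of the space of sections of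
    [O(p, n)]. *)
Lemma size_section_basis p n : (size (section_basis p n) * 2 = p.+1 * n.+1 * (p + n).+2)%N.
Proof.
rewrite /section_basis size_allpairs_dep_sum big_allpairs_dep /=.
have E m x : (\sum_(b <- iota 0 m.+1) (x + (m - b)).+1 * 2 = m.+1 * (2 * x + m.+2))%N.
  rewrite -{1}[m.+1]subn0 -/(index_iota 0 m.+1).
  have -> : (\sum_(0 <= b < m.+1) (x + (m - b)).+1 * 2 = \sum_(0 <= b < m.+1) (m.+1 - b) * 2 +
      \sum_(0 <= b < m.+1) x * 2)%N.
    rewrite -big_split /=; apply: eq_big_nat => b /andP[_ bm]; rewrite ltnS in bm.
    by rewrite subSn //; lia.
  by rewrite sum_rev sum_nat_const_nat; lia.
rewrite big_distrl /=.
under eq_bigr => i _.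
  rewrite big_distrl /=; under eq_bigr => b _ do rewrite size_iota.
  rewrite E; over.
have -> : (\sum_(i <- iota 0 p.+1) n.+1 * (2 * (p - i) + n.+2) = n.+1 * \sum_(i <- iota 0 p.+1)
    ((p - i).+1 * 2 + n))%N.
  by rewrite big_distrr /=; apply: eq_bigr => i _; lia.
rewrite big_split /= (E p 0%N) sum_const_seq /= size_iota; lia.
Qed.

Section Counting.
Variable K : numClosedFieldType.
Notation W := {poly {poly {poly K}}}.

Lemma coef_section_eval p n (c : nat * nat * nat -> K) (X Y M : W) (j b i : nat) :
  (@section_eval p n K W (@cst K) c X Y M)`_j`_b`_i =
  \sum_(t <- section_basis p n) c t * (section_monomial p X Y M t)`_j`_b`_i.
Proof.
by rewrite /section_eval !coef_sum; apply: eq_bigr => t _; rewrite /cst /= !coefCM.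
Qed.

Variable q : seq (K * K).
Let k := size q.
Hypothesis k3 : (3 <= k)%N.
Hypothesis uniq_q : uniq [seq l.1 | l <- q].
Hypothesis q_neq0 : forall l, l \in q -> l.1 != 0.
Hypothesis collinear : forall a b : K,
  (3 * count (fun l => l.2 == a * l.1 + b)%R q <= 2 * k)%N.
Variable pts : seq (K * K).
Hypothesis uniq_pts : uniq pts.
Hypothesis pts_neq0 : forall z, z \in pts -> z.1 != 0.

Definition on_line (z l : K * K) := z.2 == l.2 * z.1 + l.1.

(** Order [h] in the two offsets for every power of the slope, that is, along the whole fibre over
    the point. *)
Definition point_conditions n (h : nat) : seq (nat * nat * nat) :=
  [seq (w.1, w.2, j) | w <- [seq (i, b) | i <- iota 0 h, b <- iota 0 n.+1], j <- iota 0 (h -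
      w.1)].

(* The [a], [b]-coefficient along a line has degree at most [p + b - a] in [x]
   and, by the conditions at the points, zeros of order [h z - a] on it; so it
   is enough to kill it to the complementary order at [x = 0]. *)
Definition line_conditions p n (h : K * K -> nat) (l : K * K) : seq (nat * nat * nat) :=
  [seq (w.1, w.2, s) | w <- [seq (a, b) | a <- iota 0 n.+1, b <- iota 0 ((3 * n - k * a + 2) %/
      3)],
       s <- iota 0 (p.+1 + w.2 - w.1 - \sum_(z <- pts | on_line z l) (h z - w.1))].

(** Otherwise some nonzero section satisfies all the conditions, against [sections_vanish]. *)
Lemma size_basis_le_conditions p n (h : K * K -> nat) : (0 < n)%N -> (n <= p)%N ->
  (size (section_basis p n) <= size (point_conditions n (p - n).+1) +
     (\sum_(z <- pts) size (point_conditions n (h z)) + \sum_(l <- q) size (line_conditions p n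
         h l)))%N.
Proof.
move=> n0 np; rewrite leqNgt; apply/negP => lt.
pose X (z : K * K) : W := ('X + z.1%:P)%:P%:P.
pose Y (z : K * K) : W := 'X + z.2%:P%:P%:P.
pose X' : W := 'X%:P%:P.
pose Y' (l : K * K) : W := 'X + (l.2%:P * 'X + l.1%:P)%:P%:P.
pose M' (l : K * K) : W := ('X + l.2%:P%:P)%:P.
(* The flag tells points from lines. The exponent of [x] comes first in a point condition and last
   in a line condition. *)
pose phi (j : bool * (K * K) * (nat * nat * nat)) (t : nat * nat * nat) : K :=
  let: (isp, z, (u, v, w)) := j in
  if isp then (section_monomial p (X z) (Y z) ('X%:P : W) t)`_w`_v`_u
  else (section_monomial p X' (Y' z) (M' z) t)`_u`_v`_w.
pose S := [seq (true, (0, 0), e) | e <- point_conditions n (p - n).+1] ++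
   ([seq (true, z, e) | z <- pts, e <- point_conditions n (h z)] ++
    [seq (false, l, e) | l <- q, e <- line_conditions p n h l]) : seq (bool * (K * K) * (nat *
        nat * nat)).
have sS : (size S < size (section_basis p n))%N.
  rewrite 2!size_cat size_map [X in (_ + (X + _) < _)%N]size_allpairs_dep_sum.
  by rewrite [X in (_ + (_ + X) < _)%N]size_allpairs_dep_sum.
have [c [c0 coff hc]] := linear_system_solution phi (uniq_section_basis p n) sS.
have mi m x : (x \in iota 0 m) = (x < m)%N by rewrite mem_iota.
have memp m i b j : (i + j < m)%N -> (b <= n)%N -> (i, b, j) \in point_conditions n m.
  move=> lt' bn; apply/allpairsPdep; exists (i, b), j.
  split=> [||//]; last by rewrite mi /=; lia.
  by apply/allpairsPdep; exists i, b; split; rewrite ?mi //; lia.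
have hp z i b j : (true, z, (i, b, j)) \in S -> (at_point p n c z)`_j`_b`_i = 0.
  by move=> /hc; rewrite /at_point coef_section_eval.
apply: (@sections_vanish K p n c n0 np coff c0 q k3 uniq_q q_neq0 collinear).
  move=> i b j le bn; apply: hp; rewrite mem_cat; apply/orP; left.
  by apply/map_f/memp.
move=> l lq; apply: (@at_line_vanish K p n c k l [seq z <- pts | on_line z l] h k3).
- exact: filter_uniq.
- by move=> z; rewrite mem_filter => /andP[/eqP e zp]; split=> //; exact: pts_neq0.
- move=> z; rewrite mem_filter => /andP[_ zp] i b j lt' bn; apply: hp.
  rewrite !mem_cat; apply/or3P; apply: Or32; apply/allpairsPdep.
  by exists z, (i, b, j); split=> //; apply: memp.
- move=> a b s hab hs; rewrite /at_line coef_section_eval.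
  apply: (hc (false, l, (a, b, s))); rewrite !mem_cat; apply/or3P; apply: Or33.
  apply/allpairsPdep; exists l, (a, b, s); split=> //.
  rewrite big_filter in hs.
  apply/allpairsPdep; exists (a, b), s; split; rewrite ?mi //.
  apply/allpairsPdep; exists a, b; split; rewrite ?mi //; last by lia.
  have : (3 * a <= k * a)%N by rewrite leq_mul2r k3 orbT.
  by lia.
Qed.


Lemma size_point_conditions n h : (size (point_conditions n h) * 2 = n.+1 * (h * h.+1))%N.
Proof.
rewrite /point_conditions size_allpairs_dep_sum big_allpairs_dep /= -sum_rev big_distrl
    big_distrr /=.
rewrite /index_iota subn0; apply: eq_bigr => i _.
rewrite sum_const_seq size_iota (_ : size (iota 0 n.+1) = n.+1) ?size_iota //; lia.
Qed.

Lemma sum_iota_add X B : ((\sum_(b <- iota 0 B) (X + b)) * 2 + B = 2 * B * X + B * B)%N.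
Proof.
elim: B => [|B IHB]; first by rewrite big_nil.
rewrite -[B.+1]addn1 iotaD big_cat /= big_seq1 add0n; move: IHB.
set s := (\sum_(b <- _) _)%N; lia.
Qed.

Lemma sum_quadratic (al be ga : int) (M : nat) :
  6 * (\sum_(0 <= a < M) (al + be * a%:Z + ga * a%:Z ^+ 2)) =
  6 * al * M%:Z + 3 * be * M%:Z * (M%:Z - 1) + ga * (M%:Z - 1) * M%:Z * (2 * M%:Z - 1).
Proof.
elim: M => [|M IHM]; first by rewrite big_geq //; ring.
by rewrite big_nat_recr //= mulrDr IHM -[M.+1]addn1 PoszD; ring.
Qed.

Section Scaled.
Variables (E N : nat).
Definition mult_of (z : K * K) := count (on_line z) q.
Hypothesis r2 : forall z, z \in pts -> (2 <= mult_of z)%N.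
Hypothesis N0 : (0 < N)%N.
(** Along a line [k a < 3 n] means [a < 6 N], and [h z >= 6 N] at a point of multiplicity at least
    2, so [h z - a] is never truncated. *)
Let n := (2 * k * N)%N.
Let p := ((2 * k + E) * N)%N.
Let h z := (3 * mult_of z * N)%N.

(* [108] times an upper bound for the number of conditions along a line on which
   there are [t] points whose multiplicities add up to [R]. For each [a < 6 N]
   there are at most [(u0 - k * a) / 3] values of [b], and their conditions number
   at most [(6 * u * Q + u ^ 2) / 18] where [u = u0 - k * a] and
   [Q = Q0 + (t - 1) * a]; [al], [be], [ga] are the coefficients of that
   polynomial in [a]. *)
Definition line_cost (k E N R t : int) : int :=
  let u0 := 6 * k * N + 2 in let Q0 := (2 * k + E) * N + 1 - 3 * N * R in
  let al := 6 * u0 * Q0 + u0 ^+ 2 in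
  let be := 6 * (u0 * (t - 1) - k * Q0) - 2 * k * u0 in
  let ga := k ^+ 2 - 6 * k * (t - 1) in let M := 6 * N in
  6 * al * M + 3 * be * M * (M - 1) + ga * (M - 1) * M * (2 * M - 1).

(** The bound by [E] makes the subtractions in [X a] exact, so [X a] is affine in [a] and the count
    is bounded by a sum of quadratic polynomials in [a]. *)
Lemma size_line_conditions l : (3 * \sum_(z <- pts | on_line z l) mult_of z <= E)%N ->
  108 * (size (line_conditions p n h l))%:Z <=
  line_cost k%:Z E%:Z N%:Z (\sum_(z <- pts | on_line z l) mult_of z)%N%:Z (count (on_line^~ l)
      pts)%:Z.
Proof.
set R := (\sum_(z <- _ | _) _)%N => RE; set t := count _ _.
have NR : (3 * N * R <= E * N)%N by rewrite -mulnA mulnCA [(E * N)%N]mulnC leq_mul2l RE orbT.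
have sumE a : (a < 6 * N)%N -> (\sum_(z <- pts | on_line z l) (h z - a) + a * t = 3 * N * R)%N.
  move=> aN; rewrite /t -sum1_count big_distrr /= -big_split /= /R big_distrr /=.
  rewrite big_seq_cond [RHS]big_seq_cond; apply: eq_bigr => z /andP[zp _].
  have := r2 zp => r2z; have : (6 * N <= h z)%N by have := leq_mul (leqnn (3 * N)) r2z; rewrite
      /h; lia.
  by rewrite /h; lia.
rewrite /line_conditions size_allpairs_dep_sum big_allpairs_dep /=.
pose B a := ((3 * n - k * a + 2) %/ 3)%N.
pose X a := (p.+1 - a - (3 * N * R - a * t))%N.
have kN : (3 * N <= k * N)%N by rewrite leq_mul2r k3 orbT.
have nE : (6 * N <= n.+1)%N by rewrite /n; lia.
have -> : (\sum_(a <- iota 0 n.+1) \sum_(b <- iota 0 (B a))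
     size (iota 0 (p.+1 + b - a - \sum_(z <- pts | on_line z l) (h z - a))) =
   \sum_(0 <= a < 6 * N) \sum_(b <- iota 0 (B a)) (X a + b))%N.
  rewrite -{1}[n.+1]subn0 -/(index_iota 0 n.+1) (big_cat_nat (leq0n (6 * N)) nE) /=.
  rewrite [X in (_ + X)%N]big_nat_cond [X in (_ + X)%N]big1 ?addn0; last first.
    move=> a /andP[/andP[Na _] _]; rewrite (_ : B a = 0%N) ?big_nil //.
    rewrite /B (_ : 3 * n - k * a = 0)%N //.
    apply/eqP; rewrite subn_eq0 /n; have := leq_mul (leqnn k) Na; lia.
  apply: eq_big_nat => a /andP[_ aN]; apply: eq_bigr => b _; rewrite size_iota.
  have := sumE a aN; rewrite /X /p => e; have : (a * t <= 3 * N * R)%N by lia.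
  lia.
(* With [B = B a], the sum is [B X + B (B - 1) / 2], and [3 B <= u] for [u = 6 k N + 2 - k a]. *)
have term a : (a < 6 * N)%N ->
    (18 * \sum_(b <- iota 0 (B a)) (X a + b) <= 6 * (6 * k * N + 2 - k * a) * X a + (6 * k * N
        + 2 - k * a) ^ 2)%N.
  move=> aN; have ka : (k * a <= 6 * k * N)%N by have := leq_mul (leqnn k) (ltnW aN); lia.
  have : (3 * B a <= 6 * k * N + 2 - k * a)%N.
    rewrite mulnC; apply: leq_trans (leq_trunc_div _ _) _; rewrite /n; lia.
  move: (sum_iota_add (X a) (B a)).
  set s := (\sum_(b <- _) _)%N.
  by move: (6 * k * N + 2 - k * a)%N s (B a) (X a) => u s b x; nia.
have XE a : (a < 6 * N)%N -> (X a)%:Z = (2 * k%:Z + E%:Z) * N%:Z + 1 - 3 * N%:Z * R%:Z + (t%:Z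
    - 1) * a%:Z.
  move=> aN; have := sumE a aN => e; have : (X a + 3 * N * R + a = p.+1 + a * t)%N by rewrite
      /X /p; lia.
  by rewrite /p; lia.
set S := (\sum_(0 <= a < _) _)%N.
apply: (@le_trans _ _ (6 * (18 * S%:Z))); first by lia.
rewrite /line_cost; set u0 := 6 * k%:Z * N%:Z + 2; set Q0 := (2 * k%:Z + _) * _ + 1 - _.
have := sum_quadratic (6 * u0 * Q0 + u0 ^+ 2) (6 * (u0 * (t%:Z - 1) - k%:Z * Q0) - 2 * k%:Z *
    u0)
   (k%:Z ^+ 2 - 6 * k%:Z * (t%:Z - 1)) (6 * N)%N.
rewrite PoszM => <-; rewrite ler_pM2l //.
rewrite -PoszM /S big_distrr /= (big_morph Posz PoszD (erefl (Posz 0))).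
apply: ler_sum_nat => a /andP[_ aN].
have := term a aN; rewrite -lez_nat => /le_trans; apply.
have ka : (k * a <= 6 * k * N + 2)%N by have := leq_mul (leqnn k) (ltnW aN); lia.
have := XE a aN; rewrite -mulnn PoszD !PoszM -subzn // => ->.
rewrite le_eqVlt; apply/orP; left; apply/eqP; rewrite PoszD !PoszM /u0 /Q0; ring.
Qed.


(** Hence the costs of all lines add up to an expression in [sum_mult_sq] and [sum_mult]. *)
Lemma line_cost_affine (k' E' N' R t : int) : line_cost k' E' N' R t = line_cost k' E' N' 0 0 +
  (line_cost k' E' N' 1 0 - line_cost k' E' N' 0 0) * R + (line_cost k' E' N' 0 1 - line_cost
      k' E' N' 0 0) * t.
Proof. rewrite /line_cost; ring. Qed.

Definition sum_mult := (\sum_(z <- pts) mult_of z)%N.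
Definition sum_mult_sq := (\sum_(z <- pts) mult_of z ^ 2)%N.

Lemma sum_count_on : (\sum_(l <- q) count (on_line^~ l) pts = sum_mult)%N.
Proof.
rewrite /sum_mult /mult_of; under eq_bigr => l _ do rewrite -sum1_count big_mkcond.
by rewrite exchange_big /=; apply: eq_bigr => z _; rewrite -sum1_count [RHS]big_mkcond.
Qed.

Lemma sum_r_on : (\sum_(l <- q) \sum_(z <- pts | on_line z l) mult_of z = sum_mult_sq)%N.
Proof.
rewrite /sum_mult_sq; under eq_bigr => l _ do rewrite big_mkcond.
rewrite exchange_big /=; apply: eq_bigr => z _.
by rewrite -big_mkcond /= big_const_seq iter_addn addn0 mulnn.
Qed.

(** The right side is 108 times the difference between an upper bound for the number of conditions
    and the dimension. Its coefficient of [N ^ 3] is free of [E]. *)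
Lemma scaled_ineq : (forall l, l \in q -> 3 * \sum_(z <- pts | on_line z l) mult_of z <= E)%N ->
  let k := k%:Z in let E := E%:Z in let N := N%:Z in
  let sum_mult := sum_mult%:Z in let sum_mult_sq := sum_mult_sq%:Z in
  0 <= 108 * k * (8 * k ^+ 2 - 12 * k - 9 * sum_mult_sq + 12 * sum_mult) * N ^+ 3 +
    (108 * k * E + 324 * k * sum_mult - 810 * sum_mult_sq + 648 * k ^+ 2 - 1296 * k + 324 * k
        ^+ 3
      + 108 * k ^+ 2 * E - 324 * k * sum_mult_sq + 1296 * sum_mult) * N ^+ 2 +
    (360 * k - 54 * sum_mult + 216 * k ^+ 2 + 6 * k ^+ 3 - 36 * k * sum_mult) * N.
Proof.
move=> hE /=.
have n0 : (0 < n)%N by rewrite /n; have := leq_mul k3 N0; lia.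
have np : (n <= p)%N by rewrite /n /p leq_mul2r leq_addr orbT.
have := @size_basis_le_conditions p n h n0 np.
have pn : (p - n = E * N)%N by rewrite /p /n mulnDl addKn.
have b0 := size_section_basis p n.
have b1 := size_point_conditions n (p - n).+1.
have b2 : ((\sum_(z <- pts) size (point_conditions n (h z))) * 2 = n.+1 * (9 * N ^ 2 *
    sum_mult_sq + 3 * N * sum_mult))%N.
  rewrite big_distrl /= /sum_mult /sum_mult_sq !big_distrr /= -big_split /= big_distrr /=.
  by apply: eq_bigr => z _; rewrite size_point_conditions /h; lia.
have b3 : 108 * (\sum_(l <- q) size (line_conditions p n h l))%N%:Z <=
   k%:Z * line_cost k%:Z E%:Z N%:Z 0 0 +
  (line_cost k%:Z E%:Z N%:Z 1 0 - line_cost k%:Z E%:Z N%:Z 0 0) * sum_mult_sq%:Z +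
  (line_cost k%:Z E%:Z N%:Z 0 1 - line_cost k%:Z E%:Z N%:Z 0 0) * sum_mult%:Z.
  rewrite -sum_count_on -sum_r_on !(big_morph Posz PoszD (erefl (Posz 0))) !big_distrr /=.
  have -> : k%:Z * line_cost k%:Z E%:Z N%:Z 0 0 = \sum_(l <- q) line_cost k%:Z E%:Z N%:Z 0 0.
    by rewrite big_const_seq count_predT iter_addr addr0 -mulr_natl natz.
  rewrite -!big_split /= big_seq [leRHS]big_seq; apply: ler_sum => l lq.
  by rewrite -line_cost_affine; apply: size_line_conditions; apply: hE.
move: b0 b1 b2 b3; rewrite pn.
move: (size (section_basis p n)) (size (point_conditions n _)) (\sum_(z <- pts) size _)%N
    (\sum_(l <- q) size _)%N.
move=> x0 x1 x2 x3 e0 e1 e2 e3 le.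
have {}le : 54 * (x0 * 2)%N%:Z <= 54 * (x1 * 2)%N%:Z + 54 * (x2 * 2)%N%:Z + 108 * x3%:Z by lia.
rewrite e0 e1 e2 in le.
have := le_trans le (lerD (lexx _) e3); rewrite -subr_ge0; congr (0 <= _).
rewrite /line_cost /p /n -!mulnn !(intS, PoszD, PoszM); ring.
Qed.

End Scaled.

Lemma cubic_leading_ge0 (a b c : int) :
  (forall N : nat, (0 < N)%N -> 0 <= a * N%:Z ^+ 3 + b * N%:Z ^+ 2 + c * N%:Z) -> 0 <= a.
Proof.
move=> h; rewrite leNgt; apply/negP => a0.
(* At this [N] the two lower terms are at most [(N - 1) N^2], while [a <= -1]. *)
have := h (`|b| + `|c| + 1)%N; rewrite addn1 => /(_ isT); apply/negP; rewrite -ltNge.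
set N := (_.+1)%:Z; have NE : N = `|b| + `|c| + 1 by rewrite /N -addn1 !PoszD !abszE.
have h1 : a * N ^+ 3 <= - N ^+ 3.
  by rewrite -mulN1r ler_wpM2r ?exprn_ge0 //; lia.
have h2 : b * N ^+ 2 <= `|b| * N ^+ 2 by rewrite ler_wpM2r ?exprn_ge0 // ler_norm.
have h3 : c * N <= `|c| * N ^+ 2.
  rewrite (le_trans (ler_wpM2r _ (ler_norm c))) // ler_wpM2l // expr2 ler_peMl //; lia.
have h4 : - N ^+ 3 + `|b| * N ^+ 2 + `|c| * N ^+ 2 = - N ^+ 2 by rewrite NE; ring.
have h5 : 0 < N ^+ 2 by rewrite exprn_gt0.
lia.
Qed.

Theorem incidence_ineq : (forall z, z \in pts -> (2 <= mult_of z)%N) ->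
  (9 * sum_mult_sq + 12 * k <= 8 * k ^ 2 + 12 * sum_mult)%N.
Proof.
(* This [E] dominates the sum over the points of any one line. *)
move=> r2; pose E := (3 * sum_mult)%N.
have hE l : l \in q -> (3 * \sum_(z <- pts | on_line z l) mult_of z <= E)%N.
  by move=> _; rewrite leq_mul2l /sum_mult [leqRHS](bigID (on_line^~ l)) /= leq_addr.
have /cubic_leading_ge0 := fun N N0 => @scaled_ineq E N r2 N0 hE.
rewrite pmulr_rge0; last by rewrite mulr_gt0 // ltz_nat (leq_trans _ k3).
rewrite -mulnn; lia.
Qed.

End Counting.

(** * Arrangements of projective lines *)

Section Projective.
Variable C : numClosedFieldType.
Notation V := 'rV[C]_3.
Implicit Types l p : {vspace V}.

Definition basismx l : 'M[C]_(\dim l, 3) := \matrix_i (vbasis l)`_i.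

Definition covector l : 'cV[C]_3 := (nz_row (kermx (basismx l)^T))^T.

(** The kernel of a nonzero linear form has dimension at most 2 and contains [l], so it equals
    [l]. *)
Lemma covectorP l : \dim l = 2 ->
  covector l != 0 /\ forall v, (v \in l) = (v *m covector l == 0).
Proof.
move=> dl; set M := basismx l; set v := nz_row (kermx M^T).
have v0 : v != 0.
  rewrite nz_row_eq0 -mxrank_eq0 mxrank_ker subn_eq0 -ltnNge mxrank_tr.
  by apply: leq_ltn_trans (rank_leq_row _) _; rewrite dl.
have /sub_kermxP vM : (v <= kermx M^T)%MS by apply: nz_row_sub.
rewrite /covector -/M -/v; split; first by rewrite trmx_eq0.
have Mq : M *m v^T = 0 by rewrite -[M]trmxK -trmx_mul vM trmx0.
pose f := linfun (mulmxr v^T : V -> 'M[C]_1).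
have lf : (l <= lker f)%VS.
  apply/subvP => w wl; rewrite memv_ker lfunE /= [w](coord_vbasis wl) mulmx_suml.
  apply/eqP; rewrite big1 // => i _; rewrite -scalemxAl.
  have /(congr1 (row i)) := Mq; rewrite row_mul rowK row0 => ->.
  by rewrite scaler0.
have dk : (\dim (lker f) <= 2)%N.
  have := limg_ker_dim f fullv; rewrite capfv dimvf /dim /= => e.
  suff : (0 < \dim (f @: fullv))%N by move: e; clear; lia.
  rewrite lt0n dimv_eq0.
  apply: contra v0 => /eqP f0; apply/eqP/rowP => j; rewrite mxE.
  have : f (delta_mx 0 j) \in (f @: fullv)%VS by rewrite memv_img ?memvf.
  rewrite f0 memv0 lfunE /= -rowE => /eqP/matrixP/(_ 0 0).
  by rewrite !mxE.
have -> : l = lker f by apply/eqP; rewrite eqEdim lf dl.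
by move=> w; rewrite memv_ker lfunE.
Qed.

Lemma common_nonroot (s : seq {poly C}) : (forall P, P \in s -> P != 0) ->
  exists t, forall P, P \in s -> P.[t] != 0.
Proof.
move=> h; have : \prod_(P <- s) P != 0.
  by rewrite prodf_seq_neq0; apply/allP => P /h ->.
move/closed_nonrootP => [t nr]; exists t => P Ps; apply: contraNneq nr => e.
by rewrite (perm_big _ (perm_to_rem Ps)) big_cons rootM /root e eqxx.
Qed.

(** A point of a conic. A nonzero linear form restricts to a nonzero polynomial in [t], so points in
    general position are found as nonroots. *)
Definition moment (t : C) : V := \row_j t ^+ j.

Lemma moment_covector (t : C) (q : 'cV[C]_3) : moment t *m q = (rVpoly q^T).[t]%:M.
Proof.
apply/matrixP => i j; rewrite !mxE !ord1 eqxx mulr1n.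
rewrite (horner_coef_wide _ (size_poly _ _)); apply: eq_bigr => a _.
by rewrite mxE coef_rVpoly_ord mxE mulrC.
Qed.

Lemma rVpoly_neq0 (q : 'cV[C]_3) : q != 0 -> rVpoly q^T != 0.
Proof.
apply: contraNneq => e; rewrite -[q]trmxK -[q^T]rVpolyK e linear0 trmx0; exact: eqxx.
Qed.

(** The coordinate triangle has its vertices on the conic, at [t0], [t1], [t2], and the coefficients
    of a line are the values of its form there. The parameters avoid the roots of the forms and of
    the [P2], which detect coinciding ratios. *)
Lemma affine_chart (ls : seq {vspace V}) : (forall l, l \in ls -> \dim l = 2) ->
  exists U : 'M[C]_3, exists m c : {vspace V} -> C,
  [/\ U \in unitmx,
    forall l, l \in ls -> forall w : V,
      (w *m U \in l) = (w 0 1 == m l * w 0 0 + c l * w 0 (inord 2)),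
    forall l, l \in ls -> c l != 0,
    {in ls &, injective m} & {in ls &, injective c}].
Proof.
move=> dls.
pose e l t := (rVpoly (covector l)^T).[t].
pose P2 t l l' := e l' t *: rVpoly (covector l)^T - e l t *: rVpoly (covector l')^T.
have eq0 l : l \in ls -> rVpoly (covector l)^T != 0.
  by move=> /dls/covectorP[q0 _]; apply: rVpoly_neq0.
have [t1 ht1] : exists t1, forall P, P \in [seq rVpoly (covector l)^T | l <- ls] -> P.[t1] != 0.
  by apply: common_nonroot => P /mapP[l /eq0 ? ->].
have e1 l : l \in ls -> e l t1 != 0 by move=> lls; apply: ht1; apply: map_f.
have P2_neq0 l l' : l \in ls -> l' \in ls -> l != l' -> P2 t1 l l' != 0.
  move=> hl hl'; apply: contra_neq => h.
  have hq : e l' t1 *: covector l = e l t1 *: covector l'.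
    apply: trmx_inj; apply: (can_inj rVpolyK); apply/eqP.
    by rewrite !linearZ /= -subr_eq0; apply/eqP.
  have [[_ m1] [_ m2]] := (covectorP (dls l hl), covectorP (dls l' hl')).
  apply/vspaceP => v; rewrite m1 m2.
  have := congr1 (mulmx v) hq; rewrite -!scalemxAr => /eqP.
  case: (eqVneq (v *m covector l) 0) => [->|n1].
    by rewrite scaler0 eq_sym scaler_eq0 (negPf (e1 l hl)) /= => ->; rewrite ?eqxx.
  case: (eqVneq (v *m covector l') 0) => [->|n2 //].
  by rewrite scaler0 scaler_eq0 (negPf (e1 l' hl')) (negPf n1).
pose good ts := [seq rVpoly (covector l)^T | l <- ls] ++ ([seq 'X - t%:P | t <- ts] ++
  [seq P2 t1 l l' | l <- ls, l' <- [seq l' <- ls | l' != l]]).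
have good_neq0 ts P : P \in good ts -> P != 0.
  rewrite !mem_cat => /or3P[/mapP[l /eq0 ? ->]|/mapP[t _ ->]|] //; first by rewrite
      polyXsubC_eq0.
  move=> /allpairsPdep[l [l' [hl]]]; rewrite mem_filter => /andP[ne hl'] ->.
  by apply: P2_neq0; rewrite // eq_sym.
have good_sep ts t : (forall P, P \in good ts -> P.[t] != 0) ->
   [/\ forall l, l \in ls -> e l t != 0, forall t', t' \in ts -> t != t' &
     {in ls &, injective (fun l => e l t / e l t1)}].
  move=> h; split.
  - by move=> l hl; apply: h; rewrite mem_cat; apply/orP; left; apply/mapP; exists l.
  - move=> t' ht'; have := h ('X - t'%:P); rewrite /good !mem_cat (map_f (fun t => 'X - t%:P)
      ht') orbT => /(_ isT).
    by rewrite hornerXsubC subr_eq0.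
  - move=> l l' hl hl' /= /eqP; rewrite eqr_div ?e1 // => /eqP E; apply/eqP/negPn/negP => ne.
    have := h (P2 t1 l l'); rewrite !mem_cat => /(_ _)/negP[].
      apply/or3P; apply: Or33; apply/allpairsPdep; exists l, l'; split=> //.
      by rewrite mem_filter hl' eq_sym ne.
    by rewrite hornerD hornerN !hornerZ -!/(e _ _) [e l' t1 * _]mulrC E mulrC subrr.
have [t0 /good_sep[_ h01 h0]] := common_nonroot (good_neq0 [:: t1]).
have [t2 /good_sep[e2 h21 h2]] := common_nonroot (good_neq0 [:: t0; t1]).
have n01 : t0 != t1 by apply: h01; rewrite mem_head.
have n20 : t2 != t0 by apply: h21; rewrite mem_head.
have n21 : t2 != t1 by apply: h21; rewrite !inE eqxx orbT.
pose T : 'I_3 -> C := fun i => nth 0 [:: t0; t1; t2] i.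
pose U : 'M[C]_3 := \matrix_i moment (T i).
have UE (w : V) : w *m U = w 0 0 *: moment t0 + w 0 1 *: moment t1 + w 0 (inord 2) *: moment t2.
  rewrite mulmx_sum_row !big_ord_recl big_ord0 addr0 !rowK addrA.
  congr (_ *: _ + _ *: _ + _ *: _).
    by congr (w _ _); apply/val_inj.
  by congr (w _ _); apply/val_inj; rewrite /= inordK.
exists U, (fun l => - (e l t0 / e l t1)), (fun l => - (e l t2 / e l t1)); split.
(* A kernel vector would be a polynomial of degree at most 2 with three roots. *)
- rewrite unitmxE unitfE; apply/negP => /eqP/(congr1 (fun x => x == 0)).
  rewrite eqxx -det_tr => /det0P[v v0 vU].
  have : rVpoly v != 0 by rewrite -[v]trmxK; apply: rVpoly_neq0; rewrite trmx_eq0.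
  move=> pv; have := @max_poly_roots _ (rVpoly v) [:: t0; t1; t2] pv; rewrite /= !inE negb_or
      n01 ![_ == t2]eq_sym n20 n21 !andbT.
  have rt i : root (rVpoly v) (T i).
    apply/rootP; have h : (v *m U^T) 0 i = 0 by rewrite vU mxE.
    have := moment_covector (T i) v^T; rewrite trmxK => /matrixP/(_ 0 0).
    rewrite [in RHS]mxE eqxx mulr1n => <-; rewrite -h !mxE.
    by apply: eq_bigr => j _; rewrite !mxE mulrC.
  have := (rt 0, rt 1, rt (inord 2)).
  rewrite /T /= inordK // => -[[-> ->] ->] /(_ isT isT).
  by rewrite ltnNge size_poly.
- move=> l hl w; have [_ ->] := covectorP (dls l hl).
  have eE : w *m U *m covector l = (w 0 0 * e l t0 + w 0 1 * e l t1 + w 0 (inord 2) * e l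
      t2)%:M.
    by rewrite UE !mulmxDl -!scalemxAl !moment_covector !scale_scalar_mx -!raddfD.
  rewrite eE; have -> (x : C) : (x%:M == 0 :> 'M[C]_1) = (x == 0).
    apply/eqP/eqP => [/matrixP/(_ 0 0)|->]; last by rewrite raddf0.
    by rewrite !mxE eqxx mulr1n.
  rewrite -[RHS](inj_eq (mulfI (e1 l hl))) -[RHS]subr_eq0; congr (_ == 0).
  by field; exact: e1.
- by move=> l hl; rewrite oppr_eq0 mulf_neq0 ?invr_eq0 ?e1 ?e2.
- by move=> l l' hl hl' /oppr_inj; apply: h0.
- by move=> l l' hl hl' /oppr_inj; apply: h2.
Qed.


Lemma dim_meet l1 l2 : \dim l1 = 2 -> \dim l2 = 2 -> l1 != l2 -> \dim (l1 :&: l2) = 1.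
Proof.
move=> d1 d2 ne; have := dimv_sum_cap l1 l2; rewrite d1 d2.
have le3 : (\dim (l1 + l2) <= 3)%N.
  by have := dimvS (subvf (l1 + l2)); rewrite dimvf /dim /=.
have ge3 : (2 < \dim (l1 + l2))%N.
  rewrite ltnNge; apply: contra ne => h; rewrite eq_sym eqEdim d1 d2 andbT.
  have : l1 == (l1 + l2)%VS by rewrite eqEdim addvSl d1 h.
  by move=> /eqP ->; apply: addvSr.
by case: (\dim (l1 + l2)) le3 ge3 => [|[|[|[|]]]] // _ _ /eqP; rewrite eqn_add2l => /eqP.
Qed.

Lemma meet_unique l1 l2 p : \dim l1 = 2 -> \dim l2 = 2 -> l1 != l2 -> \dim p = 1 ->
  (p <= l1)%VS -> (p <= l2)%VS -> p = (l1 :&: l2)%VS.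
Proof.
move=> d1 d2 ne dp h1 h2; apply/eqP.
by rewrite eqEdim subv_cap h1 h2 /= dim_meet // dp.
Qed.

(** * Meeting points and their multiplicities *)

Section Arrangement.
Variable ls : seq {vspace V}.
Hypothesis uniq_ls : uniq ls.
Hypothesis dim_ls : forall l, l \in ls -> \dim l = 2.
Let k := size ls.

Definition lines_through p := count (fun l => (p <= l)%VS) ls.

Definition meets := undup [seq (l1 :&: l2)%VS | l1 <- ls, l2 <- [seq l2 <- ls | l2 != l1]].

Lemma mem_meets p : p \in meets -> exists l1 l2,
  [/\ l1 \in ls, l2 \in ls, l1 != l2 & p = (l1 :&: l2)%VS].
Proof.
rewrite mem_undup => /allpairsPdep[l1 [l2 [h1]]]; rewrite mem_filter => /andP[ne h2] ->.
by exists l1, l2; rewrite h1 h2 eq_sym ne.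
Qed.

Lemma meet_in l1 l2 : l1 \in ls -> l2 \in ls -> l1 != l2 -> (l1 :&: l2)%VS \in meets.
Proof.
move=> h1 h2 ne; rewrite mem_undup; apply/allpairsPdep; exists l1, l2.
by rewrite mem_filter eq_sym ne h2.
Qed.

Lemma dim_meets p : p \in meets -> \dim p = 1.
Proof. by move=> /mem_meets[l1 [l2 [h1 h2 ne ->]]]; apply: dim_meet; rewrite ?dim_ls. Qed.

Lemma lines_through_ge2 l1 l2 p : l1 \in ls -> l2 \in ls -> l1 != l2 ->
  (p <= l1)%VS -> (p <= l2)%VS -> (2 <= lines_through p)%N.
Proof.
move=> h1 h2 ne p1 p2; rewrite /lines_through -size_filter.
apply: (@uniq_leq_size _ [:: l1; l2]); first by rewrite /= inE ne.
by move=> l; rewrite !inE mem_filter => /orP[]/eqP->; rewrite ?p1 ?p2.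
Qed.

Lemma lines_through_meets p : p \in meets -> (2 <= lines_through p)%N.
Proof.
move=> /mem_meets[l1 [l2 [h1 h2 ne ->]]].
by apply: (lines_through_ge2 h1 h2 ne); rewrite ?capvSl ?capvSr.
Qed.

(** Ordered pairs of lines through a common meeting point are counted: an equal pair occurs once for
    each meeting point on the line, a pair of distinct lines exactly once. *)
Lemma sum_lines_through_sq :
  (\sum_(p <- meets) lines_through p ^ 2 + k = \sum_(p <- meets) lines_through p + k ^ 2)%N.
Proof.
have sq : (\sum_(p <- meets) lines_through p ^ 2 =
    \sum_(l1 <- ls) \sum_(l2 <- ls) count (fun p => (p <= l1)%VS && (p <= l2)%VS) meets)%N.
  under [RHS]eq_bigr => l1 _.
    under eq_bigr => l2 _ do rewrite -sum1_count big_mkcond.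
    by rewrite exchange_big; over.
  rewrite exchange_big /=; apply: eq_bigr => p _.
  rewrite /lines_through -mulnn -sum1_count big_mkcond big_distrl /=; apply: eq_bigr => l1 _.
  case: (p <= l1)%VS; last by rewrite mul0n big1.
  by rewrite mul1n big_mkcond.
have row l1 : l1 \in ls ->
   (\sum_(l2 <- ls) count (fun p => (p <= l1)%VS && (p <= l2)%VS) meets + 1 =
    count (fun p => (p <= l1)%VS) meets + k)%N.
  move=> h1; rewrite (bigD1_seq l1) //=.
  under eq_count => p do rewrite andbb.
  rewrite -addnA; congr (_ + _)%N; rewrite -big_filter big_seq.
  under eq_bigr => l2.
    rewrite mem_filter => /andP[ne h2].
    have -> : count (fun p => (p <= l1)%VS && (p <= l2)%VS) meets = 1%N.
      transitivity (count_mem (l1 :&: l2)%VS meets).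
        apply: eq_in_count => p pm; apply/andP/eqP => [[p1 p2]|->].
          by rewrite eq_sym in ne; exact: (meet_unique (dim_ls h1) (dim_ls h2) ne (dim_meets
              pm) p1 p2).
        by rewrite capvSl capvSr.
      by rewrite count_uniq_mem ?undup_uniq // meet_in // eq_sym.
    over.
  rewrite -big_seq sum_const_seq muln1 size_filter /k -(count_predC (pred1 l1)).
  by rewrite count_uniq_mem // h1 addnC.
have tau : (\sum_(l1 <- ls) count (fun p => (p <= l1)%VS) meets = \sum_(p <- meets)
    lines_through p)%N.
  under eq_bigr => l _ do rewrite -sum1_count big_mkcond.
  rewrite exchange_big /=; apply: eq_bigr => p _.
  by rewrite /lines_through -sum1_count [RHS]big_mkcond.
rewrite sq -tau.
have e1 : (k = \sum_(l <- ls) 1)%N by rewrite sum_const_seq muln1.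
have e2 : (k ^ 2 = \sum_(l <- ls) k)%N by rewrite sum_const_seq mulnn.
rewrite [(k ^ 2)%N]e2 [X in (_ + X = _)%N]e1.
by rewrite -!big_split /= big_seq [RHS]big_seq; apply: eq_bigr => l /row.
Qed.

Hypothesis k_gt0 : (0 < k)%N.
Hypothesis lines_through_le : forall p, \dim p = 1 -> (3 * lines_through p <= 2 * k)%N.

(** A single line violates the multiplicity bound at each of its points, two lines at their
    intersection. *)
Lemma size_ge3 : (3 <= k)%N.
Proof.
have [l1 h1] : exists l, l \in ls.
  by move: k_gt0; rewrite /k; case: ls => // l s _; exists l; rewrite mem_head.
have v0 : vpick l1 != 0 by rewrite vpick0 -dimv_eq0 dim_ls.
have := lines_through_le (_ : \dim <[vpick l1]> = 1%N); rewrite dim_vline v0 => /(_ erefl).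
have m1 : (0 < lines_through <[vpick l1]>)%N.
  by rewrite -has_count; apply/hasP; exists l1; rewrite // -memvE memv_pick.
move=> h; have k2 : (2 <= k)%N by lia.
have [l2 h2 ne] : exists2 l2, l2 \in ls & l1 != l2.
  have : (0 < count (predC1 l1) ls)%N.
    by move: k2; rewrite /k -(count_predC (pred1 l1)) count_uniq_mem // h1.
  by rewrite -has_count => /hasP[l2 h2 /= ne]; exists l2; rewrite // eq_sym.
have := lines_through_le (dim_meets (meet_in h1 h2 ne)); have := lines_through_meets (meet_in
    h1 h2 ne); lia.
Qed.

Theorem projective_ineq :
  (4 * k ^ 2 <= 3 * \sum_(p <- meets) lines_through p ^ 2)%N /\
  (k ^ 2 + 3 * k <= 3 * \sum_(p <- meets) lines_through p)%N.
Proof.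
have [U [m [c [Uu inl c0 minj cinj]]]] := affine_chart dim_ls.
pose Q := [seq (c l, m l) | l <- ls].
pose w p : V := vpick p *m invmx U.
pose aff p : C * C := (w p 0 0 / w p 0 (inord 2), w p 0 1 / w p 0 (inord 2)).
have w_neq0 p : \dim p = 1%N -> w p != 0.
  move=> dp; apply: contra_eq_neq dp => h.
  have : vpick p == 0 by rewrite -[vpick p](mulmxKV Uu) -/(w p) h mul0mx.
  by rewrite vpick0 => /eqP ->; rewrite dimv0.
have inE p l : \dim p = 1%N -> l \in ls -> (p <= l)%VS = (w p 0 1 == m l * w p 0 0 + c l * w p
    0 (inord 2)).
  move=> dp hl; rewrite -inl // mulmxKV //.
  have v0 : vpick p != 0 by rewrite vpick0 -dimv_eq0 dp.
  have {1}-> : p = <[vpick p]>%VS.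
    by apply/esym/eqP; rewrite eqEdim -memvE memv_pick dp dim_vline v0.
  by rewrite -memvE.
have row0 (u : V) : u 0 0 = 0 -> u 0 1 = 0 -> u 0 (inord 2) = 0 -> u = 0.
  move=> u0 u1 u2; apply/rowP => i; rewrite mxE.
  case: i => -[|[|[|]]] // hi; [rewrite -[RHS]u0|rewrite -[RHS]u1|rewrite -[RHS]u2];
    congr (u _ _); apply/val_inj; rewrite //= inordK //.
(* Distinct slopes exclude meeting points at infinity, and distinct positions exclude them on the
   line [x = 0]. *)
have finite p : p \in meets -> w p 0 (inord 2) != 0 /\ w p 0 0 != 0.
  move=> pm; have dp := dim_meets pm.
  have [l1 [l2 [h1 h2 ne pE]]] := mem_meets pm.
  have := inE p l1 dp h1; rewrite {1}pE capvSl => /esym/eqP e1.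
  have := inE p l2 dp h2; rewrite {1}pE capvSr => /esym/eqP e2.
  split; apply/negP => /eqP z.
  - have z0 : w p 0 0 = 0.
      apply: contraNeq ne => n0; apply/eqP/minj => //; apply: (mulIf n0).
      by move: e2; rewrite e1 z !mulr0 !addr0.
    by have := w_neq0 p dp; rewrite (row0 (w p)) ?eqxx // e1 z z0 !mulr0 addr0.
  - have z2 : w p 0 (inord 2) = 0.
      apply: contraNeq ne => n0; apply/eqP/cinj => //; apply: (mulIf n0).
      by move: e2; rewrite e1 z !mulr0 !add0r.
    by have := w_neq0 p dp; rewrite (row0 (w p)) ?eqxx // e1 z z2 !mulr0 addr0.
have onE p l : p \in meets -> l \in ls -> on_line (aff p) (c l, m l) = (p <= l)%VS.
  move=> pm hl; rewrite inE ?dim_meets // /on_line /aff /=; have [n2 _] := finite p pm.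
  by rewrite -[LHS](inj_eq (mulIf n2)) mulrDl divfK // -[m l * _ * _]mulrA divfK.
have aff_inj : {in meets &, injective aff}.
  move=> p p' pm pm' e; have [l1 [l2 [h1 h2 ne pE]]] := mem_meets pm.
  rewrite pE; apply/esym; apply: (meet_unique (dim_ls h1) (dim_ls h2) ne (dim_meets pm')).
    by rewrite -onE // -e onE // pE capvSl.
  by rewrite -onE // -e onE // pE capvSr.
have rE p : p \in meets -> mult_of Q (aff p) = lines_through p.
  move=> pm; rewrite /mult_of /lines_through count_map; apply: eq_in_count => l hl /=.
  by rewrite onE.
have sQ : size Q = k by rewrite size_map.
have coll (a b : C) : (3 * count (fun z : C * C => z.2 == a * z.1 + b)%R Q <= 2 * size Q)%N.
  (* The lines with [m = a c + b] are those through the point [(1 : b : - a)]. *)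
  rewrite sQ; pose u : V := \row_(i < 3) nth 0 [:: 1; b; - a] i.
  have u0 : u != 0.
    by apply/eqP => /rowP/(_ 0)/eqP; rewrite !mxE /= oner_eq0.
  have uU0 : u *m U != 0 by apply: contra u0 => /eqP h; rewrite -[u](mulmxK Uu) h mul0mx.
  apply: leq_trans (lines_through_le (_ : \dim <[u *m U]> = 1%N)); last by rewrite dim_vline
      uU0.
  rewrite leq_mul2l /= count_map /lines_through; apply/eq_leq/eq_in_count => l hl /=.
  rewrite -memvE inl // !mxE /= inordK // /= mulr1.
  by apply/eqP/eqP => [->|->]; ring.
have uc : uniq [seq z.1 | z <- Q] by rewrite -map_comp map_inj_in_uniq.
have Q0 z : z \in Q -> z.1 != 0 by move=> /mapP[l hl ->]; apply: c0.
have k3 : (3 <= size Q)%N by rewrite sQ size_ge3.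
have upts : uniq (map aff meets) by rewrite map_inj_in_uniq ?undup_uniq.
have pts0 z : z \in map aff meets -> z.1 != 0.
  by move=> /mapP[p pm ->] /=; have [n2 n0] := finite p pm; rewrite mulf_neq0 ?invr_eq0.
have r2 z : z \in map aff meets -> (2 <= mult_of Q z)%N.
  by move=> /mapP[p pm ->]; rewrite rE // lines_through_meets.
have := @incidence_ineq C Q k3 uc Q0 coll (map aff meets) upts pts0 r2.
rewrite /sum_mult /sum_mult_sq !big_map sQ.
have -> : (\sum_(p <- meets) mult_of Q (aff p) = \sum_(p <- meets) lines_through p)%N.
  by rewrite big_seq [RHS]big_seq; apply: eq_bigr => p /rE.
have -> : (\sum_(p <- meets) mult_of Q (aff p) ^ 2 = \sum_(p <- meets) lines_through p ^ 2)%N.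
  by rewrite big_seq [RHS]big_seq; apply: eq_bigr => p /rE ->.
have := sum_lines_through_sq; set s2 := (\sum_(p <- _) _ ^ 2)%N; set s1 := (\sum_(p <- _) _)%N.
by split; lia.
Qed.

End Arrangement.
End Projective.

(** * Transfer to the extended-real numbers of points *)

Section Transfer.
Variables (R : realType) (A : {fset (projline R)}).
Local Notation V := 'rV[R[i]]_3.

Definition lines : seq {vspace V} := [seq val l | l <- enum_fset A].

Lemma uniq_lines : uniq lines.
Proof. by rewrite map_inj_uniq ?fset_uniq //; apply: val_inj. Qed.

Lemma dim_lines l : l \in lines -> \dim l = 2%N.
Proof. by move=> /mapP[l' _ ->]; apply/eqP; exact: (valP l'). Qed.

Lemma multE (p : projpt R) : mult A p = lines_through lines (val p).
Proof.
rewrite /mult /lines_through /lines count_map -size_filter; apply: perm_size.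
apply: uniq_perm; rewrite ?filter_uniq ?fset_uniq // => l.
by rewrite mem_filter !inE andbC.
Qed.

(** For an infinite set the value is [+oo], and the bound is trivial. *)
Lemma counting_ge (T : choiceType) (X : set T) (s : seq T) :
  uniq s -> {in s, forall x, X x} -> ((size s)%:R%:E <= counting X :> \bar R)%E.
Proof.
move=> us sX; rewrite /counting; case: ifPn => [/asboolP fX|_]; last exact: leey.
rewrite lee_fin ler_nat; apply: uniq_leq_size => // x /sX xX.
by rewrite in_fset_set // mem_set.
Qed.

Definition points (r : nat) : seq (projpt R) :=
  [seq p <- pmap insub (meets lines) | mult A p == r].

Lemma size_points r : size (points r) = count (fun p => lines_through lines p == r) (meets
    lines).
Proof.
rewrite size_filter; transitivity (count (fun p => lines_through lines p == r) (map val (pmap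
    insub (meets lines) : seq (projpt R)))).
  by rewrite count_map; apply: eq_count => p /=; rewrite multE.
rewrite pmap_filter; last exact: insubK.
congr count; apply/all_filterP/allP => p /(dim_meets (@dim_lines)) dp.
by rewrite isSome_insub dp.
Qed.

Lemma t_ge r : ((count (fun p => lines_through lines p == r) (meets lines))%:R%:E <= t_ A r)%E.
Proof.
rewrite -size_points; apply: counting_ge.
  by rewrite filter_uniq // pmap_sub_uniq // undup_uniq.
by move=> p; rewrite mem_filter => /andP[/eqP].
Qed.

(** The terms are nonnegative, and the partial sum up to the number of lines already accounts for
    every meeting point, grouped by multiplicity. *)
Lemma series_ge (F : nat -> nat) :
  ((\sum_(p <- meets lines) F (lines_through lines p))%:R%:E <= \sum_(2 <= r <oo) (F r)%:R%:E *
      t_ A r)%E.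
Proof.
have tge0 r : (0 <= t_ A r)%E by apply: le_trans (t_ge r); rewrite lee_fin.
apply: le_trans (nneseries_lim_ge (size lines).+1 (P := xpredT) _); last first.
  by move=> r _ _; rewrite mule_ge0 // lee_fin.
apply: (@le_trans _ _ (\sum_(2 <= r < (size lines).+1) (F r * count (fun p => lines_through
    lines p == r) (meets lines))%:R%:E)%E); last first.
  by apply: lee_sum => r _; rewrite natrM EFinM lee_wpmul2l ?lee_fin // t_ge.
rewrite sumEFin -natr_sum lee_fin ler_nat.
under [leqRHS]eq_bigr => r _ do rewrite -sum1_count big_distrr big_mkcond.
rewrite exchange_big /= big_seq [leqRHS]big_seq; apply: leq_sum => p pm.
have h2 := lines_through_meets pm.
have hk : (lines_through lines p < (size lines).+1)%N by rewrite ltnS count_size.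
rewrite (bigD1_seq (lines_through lines p)) ?iota_uniq ?mem_index_iota ?h2 //=.
by rewrite eqxx muln1 leq_addr.
Qed.

End Transfer.

Theorem proposition11p3p1 (R : realType) (k : nat) (A : {fset (projline R)})
  (hk : #|` A|%fset = k)
  (ht : forall r : nat, 2 / 3 * k%:R < r%:R :> R -> t_ A r = 0%E) :
  (\sum_(2 <= r <oo) r%:R%:E * t_ A r >=
     (Num.ceil (1 / 3 * k%:R ^+ 2 + k%:R : R))%:~R%:E)%E /\
  (\sum_(2 <= r <oo) (r%:R ^+ 2)%:E * t_ A r >=
     (Num.ceil (4 / 3 * k%:R ^+ 2 : R))%:~R%:E)%E.
Proof.
have sk : size (lines A) = k by rewrite size_map -hk.
(* A point of multiplicity [r > 2 k / 3] would give [t_ A r >= 1], against [ht]. *)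
have mle (p : {vspace 'rV[R[i]]_3}) : \dim p = 1%N -> (3 * lines_through (lines A) p <= 2 *
    size (lines A))%N.
  move=> /eqP dp; pose P : projpt R := exist _ p dp.
  rewrite sk leqNgt; apply/negP => lt.
  have := @counting_ge R _ [set p : projpt R | mult A p = mult A P]%classic [:: P] isT.
  rewrite -/(t_ A _) ht => [h|].
    suff : (1%:R%:E <= 0%:E :> \bar R)%E by rewrite lee_fin ler10.
    by apply: h => x; rewrite inE => /eqP ->.
  by rewrite multE /=; move: lt; rewrite -(ltr_nat R) !natrM; lra.
(* For the empty arrangement both bounds are 0 and the series are nonnegative. *)
have [k0|k0] := posnP k.
  rewrite k0 expr0n !mulr0 addr0 ceil0 /=.
  have nn (F : nat -> R) : (forall r, 0 <= F r) -> (0%:E <= \sum_(2 <= r <oo) (F r)%:E * t_ A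
      r)%E.
    move=> F0; apply: nneseries_ge0 => r _ _; rewrite mule_ge0 ?lee_fin //.
    by apply: le_trans (t_ge A r); rewrite lee_fin.
  by split; apply: nn => r; rewrite ?exprn_ge0.
have [i1 i2] := projective_ineq (uniq_lines A) (@dim_lines R A) (etrans (congr1 (leq 1) sk) k0)
    mle.
rewrite sk in i1 i2.
have ceil_le (x : R) (s : nat) : x <= s%:R -> (Num.ceil x)%:~R <= s%:R :> R.
  by move=> xs; rewrite [leRHS]pmulrn ler_int ceil_le_int -pmulrn.
split.
  apply: le_trans (series_ge A id); rewrite lee_fin; apply: ceil_le.
  by move: i2; rewrite -(ler_nat R) natrD natrX !natrM; lra.
have sq r : r%:R ^+ 2 = (r ^ 2)%:R :> R by rewrite natrX.
under eq_eseriesr => r _ do rewrite sq.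
apply: le_trans (series_ge A (fun r => r ^ 2)%N); rewrite lee_fin; apply: ceil_le.
by move: i1; rewrite -(ler_nat R) [(4 * _)%:R]natrM natrX natrM; lra.
Qed.
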